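(* Let $\lambda>0$, $\eta>0$, $\rho\in(-1,1)$, let $\kappa$ be a non-negative, decreasing kernel with $\int_0^T\kappa(s)\,ds<\infty$ for all $T>0$, and let $u\in\mathbb{R}$. (a) If $u$ satisfies case (A), then $\psi_\kappa(\cdot,u)$ satisfies $$0\le\psi_1\!\left(\int_0^t\kappa(s)\,ds,u\right)\le\psi_\kappa(t,u),\qquad t\ge0.$$ (b) If $u$ satisfies case (B), then $\psi_\kappa(\cdot,u)$ satisfies $$0\le\overline\psi_1\!\left(\int_0^t\kappa(s)\,ds,u\right)\le\psi_\kappa(t,u),\qquad t\ge0,$$ where $\overline\psi_1$ is the solution of $\overline\psi_1(t,u)=\int_0^t\overline R\bigl(u,\overline\psi_1(s,u)\bigr)\,ds$, $t\ge0$, with $\overline R(u,w):=R(u,w_0(u))$ for $w\le w_0(u)$ and $\overline R(u,w):=R(u,w)$ for $w>w_0(u)$. (c) If $u$ satisfies case (C), then $\psi_\kappa(\cdot,u)$ exists globally and satisfies $$0\le\psi_\kappa(t,u)\le\psi_1\!\left(\int_0^t\kappa(s)\,ds,u\right)\le w_*(u),\qquad t\ge0.$$ (d) If $u$ satisfies case (D), then $\psi_\kappa(\cdot,u)$ exists globally and satisfies $$w_*(u)<\psi_1\!\left(\int_0^t\kappa(s)\,ds,u\right)\le\psi_\kappa(t,u)<0,\qquad t\ge0.$$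
   Context: Let $R(u,w):=\tfrac12u(u-1)+c_2(u)w+\tfrac{\eta^2}{2}w^2$ with $c_2(u)=\rho\eta u-\lambda$, and $\Delta(u):=\tfrac14\bigl((\rho\eta u-\lambda)^2-\eta^2(u^2-u)\bigr)$. A real number $u$ satisfies - case (A) if $R(u,0)>0$ and $\partial_wR(u,0)\ge0$; - case (B) if $R(u,0)>0$, $\partial_wR(u,0)<0$ and $R(u,\cdot)$ has no (real) roots; - case (C) if $R(u,0)>0$, $\partial_wR(u,0)<0$ and $R(u,\cdot)$ has positive roots; - case (D) if $R(u,0)\le0$. $\psi_\kappa(\cdot,u)$ denotes the continuous solution, on its maximal interval of existence $[0,\hat T_\kappa(u))$, of the Volterra equation $\psi_\kappa(t,u)=\int_0^t\kappa(t-s)R(u,\psi_\kappa(s,u))\,ds$. ''Exists globally'' means $\hat T_\kappa(u)=\infty$. $\psi_1$ denotes the solution for the constant kernel $\kappa\equiv1$, i.e. of $\partial_t\psi_1=R(u,\psi_1)$, $\psi_1(0,u)=0$. $w_0(u):=-c_2(u)/\eta^2$ is the location of the global minimum of $R(u,\cdot)$; $w_*(u):=\frac1{\eta^2}\bigl(-c_2(u)-2\sqrt{\Delta(u)}\bigr)$ is its first (smaller) root, whenever $\Delta(u)\ge0$. In cases (A) and (B), where solutions may explode, $\psi_\kappa,\psi_1,\overline\psi_1$ are understood to have the value $+\infty$ from the end of their maximal interval of existence onwards.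
   Formalization: (d) is false as printed and is mended: ψ_1,ψ_κ<0 is claimed only if R(u,0)<0 and ∫_0^tκ>0, w_*<ψ_1,ψ_κ only if w_*<0 (weak bounds always), and ψ_1(∫κ)≤ψ_κ only if c_2(u)≤0 or R(u,0)=0, since it fails e.g. for λ=.1, η=1, ρ=.9, u=.5, κ=e^{-t}. *)

(* Defs.v *)
From HB Require Import structures.
From mathcomp Require Import all_boot all_order all_algebra.
From mathcomp Require Import all_classical all_reals all_analysis.

Set Implicit Arguments.
Unset Strict Implicit.
Unset Printing Implicit Defensive.

Import Order.TTheory GRing.Theory Num.Theory.
Import numFieldNormedType.Exports.
Local Open Scope classical_set_scope.
Local Open Scope ring_scope.

Section Volterra.
Context {R : realType}.
Local Notation mu := (@lebesgue_measure R).

(* Kernels live on the open half-line, so that they may be singular at 0 (as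
   t `^ (alpha - 1) is); the value at 0 is irrelevant in all integrals below. *)
Definition nonneg_decreasing (kappa : R -> R) : Prop :=
  (forall t, 0 < t -> 0 <= kappa t) /\
  (forall s t, 0 < s -> s <= t -> kappa t <= kappa s).

Definition locally_integrable0 (kappa : R -> R) : Prop :=
  forall T : R, 0 < T -> (\int[mu]_(s in `[0%R, T]) (kappa s)%:E < +oo)%E.

Definition kernel_primitive (kappa : R -> R) (t : R) : R :=
  \int[mu]_(s in `[0, t]) kappa s.

Definition const_kernel : R -> R := fun=> 1.

Definition half_open (T : \bar R) : set R := [set t | 0 <= t /\ (t%:E < T)%E].

Definition volterra_solution (kappa F : R -> R) (T : \bar R) (psi : R -> R)
    : Prop :=
  {within half_open T, continuous psi} /\
  (forall t, half_open T t ->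
     (psi t)%:E = \int[mu]_(s in `[0%R, t]) (kappa (t - s) * F (psi s))%R%:E)%E.

(* [0, T[ is a maximal interval of existence: no solution on a strictly larger
   interval extends psi.  T = 0 is not excluded a priori, so a maximal solution
   always exists by Zorn's lemma and a statement about all maximal solutions
   is never vacuous. *)
Definition maximal_solution (kappa F : R -> R) (T : \bar R) (psi : R -> R)
    : Prop :=
  [/\ (0 <= T)%E,
      volterra_solution kappa F T psi &
      forall (T' : \bar R) (psi' : R -> R),
        (T < T')%E -> volterra_solution kappa F T' psi' ->
        ~ {in half_open T, psi =1 psi'}].

Definition extend_pinfty (T : \bar R) (psi : R -> R) (t : R) : \bar R :=
  if (t%:E < T)%E then (psi t)%:E else +oo%E.

End Volterra.

Section Heston.
Context {R : realType}.
Variables lambda eta rho : R.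

Definition c2 (u : R) : R := rho * eta * u - lambda.

Definition hestonR (u w : R) : R :=
  2^-1 * u * (u - 1) + c2 u * w + eta ^+ 2 / 2 * w ^+ 2.

Definition Delta (u : R) : R :=
  4^-1 * ((rho * eta * u - lambda) ^+ 2 - eta ^+ 2 * (u ^+ 2 - u)).

Definition w0 (u : R) : R := - c2 u / eta ^+ 2.

Definition wstar (u : R) : R :=
  (eta ^+ 2)^-1 * (- c2 u - 2 * Num.sqrt (Delta u)).

Definition hestonRbar (u w : R) : R :=
  if w <= w0 u then hestonR u (w0 u) else hestonR u w.

Definition caseA (u : R) : Prop :=
  0 < hestonR u 0 /\ 0 <= ((hestonR u)^`())%classic 0.

Definition caseB (u : R) : Prop :=
  [/\ 0 < hestonR u 0, ((hestonR u)^`())%classic 0 < 0 &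
      ~ exists w, hestonR u w = 0].

Definition caseC (u : R) : Prop :=
  [/\ 0 < hestonR u 0, ((hestonR u)^`())%classic 0 < 0 &
      exists2 w, 0 < w & hestonR u w = 0].

Definition caseD (u : R) : Prop := hestonR u 0 <= 0.

End Heston.

(* Main.v *)
Require Import Defs.
From HB Require Import structures.
From mathcomp Require Import all_boot all_order all_algebra.
From mathcomp Require Import all_classical all_reals all_analysis.
From mathcomp Require Import measurable_realfun ring lra.
Import Order.TTheory GRing.Theory Num.Theory.
Import numFieldNormedType.Exports.
Local Open Scope classical_set_scope.
Local Open Scope ring_scope.

(** Write K for the primitive of kappa and C f for the convolution of kappa and f.
    Since kappa is nonnegative and decreasing, for r <= t,
      C f t - C f r <= m (K t - K r - K (t - r)) + m' K (t - r)
    as soon as f >= m on [0, r] and f <= m' on [r, t]; the reversed bound holds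
    for reversed hypotheses.

    Existence and uniqueness are a Picard iteration and a Gronwall lemma for the
    weight exp (M t), in which the singular part of kappa is absorbed by the
    smallness of K near 0. They show that a bounded maximal solution is global.

    Cases (A) and (B): with G = Rbar nondecreasing below R and psi1' = G psi1,
    the function phi = psi1 o K satisfies phi <= C (G o phi), because on each cell
    of a partition the increment of phi is at most G (phi b) dK and the one of
    C (G o phi) at least G (phi a) dK, and the errors telescope. Gronwall then
    gives phi <= psi.

    Case (C): R is decreasing on [0, w_*], so monotone comparison is not available.
    At a running maximum t of psi, however, the inequality above with r a minimizer
    of psi on [t - d, t] gives (1 - q) (psi t - psi r) <= R (psi t) (K t - K r) with
    q small: psi grows at its running maxima no faster than psi1 o K does. Hence psi
    cannot cross a slightly accelerated copy of psi1 o K, nor reach the root w_*.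

    Case (D) is case (C) for x |-> - R (- x), as far as monotonicity permits. *)

(** * Integrals of the kernel *)

Section Reflection.
Context {R : realType}.
Local Notation mu := (@lebesgue_measure R).

Lemma measurable_reflect (t : R) (D : set R) :
  measurable_fun D (fun s : R => t - s).
Proof. by exact: measurable_funB. Qed.

(** Lebesgue measure is determined by its values on the intervals []a, b]], and the preimage of such
    an interval, [[t - b, t - a[], has the same length. *)
Lemma lebesgue_measure_reflect (t : R) (A : set R) : measurable A ->
  pushforward mu (fun s : measurableTypeR R => (t - s : measurableTypeR R)) A
  = mu A.
Proof.
move=> mA; apply/esym/lebesgue_measure_unique => //=.
  exact: measurable_reflect.
move=> mf _ [[a b]] _ <-.
rewrite /pushforward (_ : _ @^-1` _ = `[t - b, t - a[%classic); last first.
  apply/seteqP; split => x /=; rewrite !in_itv/= => /andP[? ?]; apply/andP; split;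
    lra.
rewrite !lebesgue_measure_itv/= !lte_fin.
rewrite (_ : (t - b < t - a) = (a < b)); last by apply/idP/idP => ?; lra.
by case: ifP => // _; rewrite -!EFinB; congr EFin; ring.
Qed.

(** Stated for nonnegative extended-real integrands because it must precede integrability: the
    integrability of the reflected kernel is deduced from it. *)
Lemma ge0_integral_reflect (g : R -> \bar R) (a b t : R) :
  measurable_fun [set: R] g -> (forall x, 0 <= g x)%E ->
  (\int[mu]_(s in `[a, b]) g (t - s)%R = \int[mu]_(s in `[(t - b)%R,
    (t - a)%R]) g s)%E.
Proof.
move=> mg g0.
rewrite (_ : `[a, b]%classic =
    (fun s : measurableTypeR R => t - s : measurableTypeR R) @^-1` `[t - b, t - a]);
      last first.
  by apply/seteqP; split => x /=; rewrite !in_itv/= => /andP[? ?]; apply/andP; split;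
    lra.
rewrite -(@ge0_integral_pushforward _ _ (measurableTypeR R)
  (measurableTypeR R) R (fun s => t - s) _ mu _ g)//=; last 2 first.
- exact: measurable_reflect.
- exact: measurable_funS mg.
apply: eq_measure_integral => //= [|mf A mA AS];
  [exact: measurable_reflect|exact: lebesgue_measure_reflect].
Qed.

End Reflection.

Definition admissible_kernel {R : realType} (kappa : R -> R) : Prop :=
  nonneg_decreasing kappa /\ locally_integrable0 kappa.

(* Extending the kernel by 0 to the closed negative half-line makes it
   measurable everywhere and changes none of the integrals. *)
Definition kernel0 {R : realType} (kappa : R -> R) (t : R) : R :=
  if 0 < t then kappa t else 0.

(** A real-valued integral, so that linearity can be used freely; [volterra_solutionP] links it to
    the extended-real integral in the definition of solutions. *)
Definition conv {R : realType} (kappa f : R -> R) (t : R) : R :=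
  \int[@lebesgue_measure R]_(s in `[0, t]) (kernel0 kappa (t - s) * f s).

(** A class stable under the operations below whose products with the kernel are all integrable; it
    replaces separate integrability hypotheses. *)
Definition bounded_measurable {R : realType} (S : R) (f : R -> R) : Prop :=
  measurable_fun (`[0, S] : set R) f /\ exists B, forall s, 0 <= s <= S ->
    `|f s| <= B.

Section KernelIntegral.
Context {R : realType} {kappa : R -> R}.
Hypothesis kappaP : admissible_kernel kappa.
Local Notation mu := (@lebesgue_measure R).
Local Notation K := (kernel_primitive kappa).

Local Notation k := (kernel0 kappa).

Lemma kernel0_ge0 t : 0 <= k t.
Proof. by rewrite /kernel0; case: ifP => // t0; apply: kappaP.1.1. Qed.

Lemma kernel0_le s t : 0 < s -> s <= t -> k t <= k s.
Proof.
by move=> s0 st; rewrite /kernel0 s0 (lt_le_trans s0 st); exact: kappaP.1.2.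
Qed.

(** By monotonicity, the superlevel sets of the kernel in the positive half-line are intervals. *)
Lemma measurable_kernel : measurable_fun (`]0, +oo[ : set R) kappa.
Proof.
apply: (measurability (@RGenCInfty.G R)) => [|/= _ [_] [r] -> <-].
  exact: RGenCInfty.measurableE.
apply: is_interval_measurable => s t/=.
rewrite !in_itv/= !andbT => -[s0 rs] [t0 rt] u /andP[su ut].
have u0 : 0 < u by exact: lt_le_trans su.
by rewrite !in_itv/= !andbT u0; split => //; apply: (le_trans rt); exact: kappaP.1.2.
Qed.

Lemma measurable_kernel0 : measurable_fun [set: R] k.
Proof.
rewrite (_ : k = kappa \_ `]0, +oo[).
  by apply/(measurable_restrictT _ _).1 => //; exact: measurable_kernel.
apply/funext => t; rewrite patchE /kernel0.
by rewrite (_ : (t \in _) = (0 < t))//; apply/idP/idP; rewrite inE/= in_itv/= andbT.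
Qed.

Lemma measurable_kernel0_reflect t (D : set R) :
  measurable_fun D (fun s => k (t - s)).
Proof.
apply: measurableT_comp; first exact: measurable_kernel0.
exact: measurable_reflect.
Qed.

Lemma integral_kernel0E t :
  (\int[mu]_(s in `[0%R, t]) (kappa s)%:E = \int[mu]_(s in `[0%R, t]) (k s)%:E)%E.
Proof.
apply: eq_integral_itv_bounded.
- by apply: (measurable_funS _ _ measurable_kernel) => //; exact: subset_itvl.
- by apply: measurable_funS measurable_kernel0.
- by move=> s; rewrite in_itv/= /kernel0 => /andP[-> _].
Qed.

Lemma kernel_primitiveE t : K t = \int[mu]_(s in `[0, t]) k s.
Proof. by rewrite /kernel_primitive /Rintegral integral_kernel0E. Qed.

Lemma integrable_kernel0 t : mu.-integrable `[0, t] (EFin \o k).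
Proof.
(* Local integrability is given for positive end points only, hence the detour through a larger
   interval. *)
have : mu.-integrable `[0, Num.max 1 t] (EFin \o k).
  apply/integrableP; split.
    by apply/measurable_EFinP; apply: measurable_funS measurable_kernel0.
  under eq_integral do rewrite /= ger0_norm ?kernel0_ge0//.
  rewrite -integral_kernel0E; apply: kappaP.2; by rewrite lt_max ltr01.
apply: integrableS => //; apply: subset_itvl; by rewrite bnd_simp le_max lexx orbT.
Qed.

Lemma integral_kernel0_reflect r t :
  (\int[mu]_(s in `[r, t]) (k (t - s))%:E = \int[mu]_(s in `[0%R, (t - r)%R])
    (k s)%:E)%E.
Proof.
rewrite (@ge0_integral_reflect _ (EFin \o k)) ?subrr//.
  by apply/measurable_EFinP; exact: measurable_kernel0.
by move=> x; rewrite lee_fin kernel0_ge0.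
Qed.

Lemma integrable_kernel0_reflect r t :
  mu.-integrable `[r, t] (EFin \o (fun s => k (t - s))).
Proof.
apply/integrableP; split.
  by apply/measurable_EFinP; exact: measurable_kernel0_reflect.
under eq_integral do rewrite /= ger0_norm ?kernel0_ge0//.
rewrite integral_kernel0_reflect.
have /integrableP[_] := integrable_kernel0 (t - r).
by under eq_integral do rewrite /= ger0_norm ?kernel0_ge0//.
Qed.

Lemma Rintegral_kernel0_reflect r t :
  \int[mu]_(s in `[r, t]) k (t - s) = K (t - r).
Proof. by rewrite kernel_primitiveE /Rintegral integral_kernel0_reflect. Qed.

End KernelIntegral.

(** * Convolution with the kernel *)

Section Convolution.
Context {R : realType} {kappa : R -> R}.
Hypothesis kappaP : admissible_kernel kappa.
Local Notation mu := (@lebesgue_measure R).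
Local Notation K := (kernel_primitive kappa).
Local Notation k := (kernel0 kappa).
Local Notation C := (conv kappa).
Implicit Types (f g : R -> R) (r s t S : R).

Lemma Rintegral_itv_split (g : R -> R) (a b c : R) : a <= b -> b <= c ->
  mu.-integrable `[a, c] (EFin \o g) ->
  \int[mu]_(s in `[a, c]) g s =
  \int[mu]_(s in `[a, b]) g s + \int[mu]_(s in `[b, c]) g s.
Proof.
move=> ab bc gi.
have := @Rintegral_itvB R g (BLeft a) (BRight c) b gi.
rewrite !bnd_simp => /(_ ab bc) h.
rewrite -[X in _ + X]Rintegral_itv_obnd_cbnd; last first.
  by apply: integrableS gi => //; apply: subset_itvr; rewrite bnd_simp.
by rewrite -h; ring.
Qed.

Lemma bounded_measurableS S (T : R) f : T <= S ->
  bounded_measurable S f -> bounded_measurable T f.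
Proof.
move=> TS [mf [B fB]]; split.
  by apply: measurable_funS mf => //; apply: subset_itvl; rewrite bnd_simp.
by exists B => s /andP[s0 sT]; apply: fB; rewrite s0 (le_trans sT).
Qed.

Lemma bounded_measurable_cst S (c : R) : bounded_measurable S (cst c).
Proof. by split; [exact: measurable_cst|exists `|c|]. Qed.

Lemma bounded_measurableN S f : bounded_measurable S f ->
  bounded_measurable S (fun s => - f s).
Proof.
move=> [mf [B fB]]; split; first exact: measurableT_comp.
by exists B => s /fB; rewrite normrN.
Qed.

Lemma bounded_measurableZ S c f : bounded_measurable S f ->
  bounded_measurable S (fun s => c * f s).
Proof.
move=> [mf [B fB]]; split; first exact: measurable_funM.
by exists (`|c| * B) => s /fB h; rewrite normrM ler_wpM2l.
Qed.

Lemma bounded_measurableD S f g : bounded_measurable S f -> bounded_measurable S g ->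
  bounded_measurable S (fun s => f s + g s).
Proof.
move=> [mf [B fB]] [mg [B' gB]]; split; first exact: measurable_funD.
by exists (B + B') => s h; rewrite (le_trans (ler_normD _ _))// lerD ?fB ?gB.
Qed.

Lemma bounded_measurable_norm S f : bounded_measurable S f ->
  bounded_measurable S (fun s => `|f s|).
Proof.
move=> [mf [B fB]]; split; first exact: measurableT_comp.
by exists B => s /fB; rewrite normr_id.
Qed.

Lemma bounded_measurable_max0 S f : bounded_measurable S f ->
  bounded_measurable S (fun s => Num.max 0 (f s)).
Proof.
move=> [mf [B fB]]; split; first exact: measurable_maxr.
exists B => s /fB h; rewrite ger0_norm ?le_max ?lexx//.
by rewrite ge_max (le_trans _ h)//= (le_trans (ler_norm _)).
Qed.

(** The reflection point x may lie beyond the interval of integration, as happens when the past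
    [[0, r]] is seen from a later time t. *)
Lemma integrable_kernel0M f S x a b : 0 <= a -> b <= x -> b <= S ->
  bounded_measurable S f ->
  mu.-integrable `[a, b] (EFin \o (fun s => k (x - s) * f s)).
Proof.
move=> a0 bx bS [mf [B fB]].
have sub : `[a, b] `<=` `[0, S]%classic.
  move=> s; rewrite /= !in_itv/= => /andP[h1 h2].
  by rewrite (le_trans a0 h1) (le_trans h2 bS).
have ki : mu.-integrable `[a, b] (EFin \o (fun s => k (x - s))).
  apply: integrableS (integrable_kernel0_reflect kappaP a x) => //.
  by apply: subset_itvl; rewrite bnd_simp.
have mf' : measurable_fun (`[a, b] : set R) f by apply: measurable_funS mf.
apply: (@integrableMl _ _ _ mu _ _ _ f ki mf') => //.
exists B; split; first exact: num_real.
move=> M BM s /sub; rewrite /= in_itv/= => /fB /le_trans; apply; exact: ltW.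
Qed.

Lemma Rintegral_kernel0_reflect0 r t : 0 <= r -> r <= t ->
  \int[mu]_(s in `[0, r]) k (t - s) = K t - K (t - r).
Proof.
move=> r0 rt.
have := Rintegral_itv_split _ _ _ _ r0 rt (integrable_kernel0_reflect kappaP 0 t).
by rewrite !Rintegral_kernel0_reflect// subr0 => ->; ring.
Qed.

Lemma conv_split f r t : 0 <= r -> r <= t -> bounded_measurable t f ->
  C f t = \int[mu]_(s in `[0, r]) (k (t - s) * f s)
        + \int[mu]_(s in `[r, t]) (k (t - s) * f s).
Proof. by move=> r0 rt bf; apply: Rintegral_itv_split => //;
  exact: integrable_kernel0M bf. Qed.

Lemma le_conv f g t : bounded_measurable t f -> bounded_measurable t g ->
  (forall s, 0 <= s <= t -> f s <= g s) -> C f t <= C g t.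
Proof.
move=> bf bg fg; apply: le_Rintegral => //.
- exact: integrable_kernel0M bf.
- exact: integrable_kernel0M bg.
- move=> s; rewrite /= in_itv/= => h; apply: ler_wpM2l (fg _ h).
  exact: kernel0_ge0.
Qed.

Lemma convZ f c t : bounded_measurable t f -> C (fun s => c * f s) t = c * C f t.
Proof.
move=> bf; rewrite /conv -RintegralZl//; last exact: integrable_kernel0M bf.
by apply: eq_Rintegral => s _; ring.
Qed.

Lemma convN f t : bounded_measurable t f -> C (fun s => - f s) t = - C f t.
Proof.
move=> bf; rewrite -[RHS]mulN1r -convZ//.
by apply: eq_Rintegral => s _; ring.
Qed.

Lemma convD f g t : bounded_measurable t f -> bounded_measurable t g ->
  C (fun s => f s + g s) t = C f t + C g t.
Proof.
move=> bf bg; rewrite /conv -RintegralD//; last 2 first.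
- exact: integrable_kernel0M bf.
- exact: integrable_kernel0M bg.
by apply: eq_Rintegral => s _; ring.
Qed.

Lemma le_Rintegral_kernel0M f S x a b m : 0 <= a -> b <= x -> b <= S ->
  bounded_measurable S f -> (forall s, a <= s <= b -> f s <= m) ->
  \int[mu]_(s in `[a, b]) (k (x - s) * f s) <=
  m * \int[mu]_(s in `[a, b]) k (x - s).
Proof.
move=> a0 bx bS bf fm.
have ki : mu.-integrable `[a, b] (EFin \o (fun s => k (x - s))).
  apply: integrableS (integrable_kernel0_reflect kappaP a x) => //.
  by apply: subset_itvl; rewrite bnd_simp.
rewrite -RintegralZl//; apply: le_Rintegral => //.
- exact: integrable_kernel0M bf.
- rewrite (_ : (fun _ => _) = (fun s => k (x - s) * cst m s)).
    by apply: integrable_kernel0M (bounded_measurable_cst S m).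
  by apply/funext => s; rewrite mulrC.
- move=> s; rewrite /= in_itv/= => h; rewrite mulrC ler_wpM2r ?fm//.
  exact: kernel0_ge0.
Qed.

(** Seen from t, the kernel has mass K t - K (t - r) on [[0, r]] and K (t - r) on [[r, t]]. *)
Lemma conv_le_split f r t m m' : 0 <= r -> r <= t -> bounded_measurable t f ->
  (forall s, 0 <= s <= r -> f s <= m) -> (forall s, r <= s <= t -> f s <= m') ->
  C f t <= m * (K t - K (t - r)) + m' * K (t - r).
Proof.
move=> r0 rt bf fm fm'; rewrite (conv_split _ r)//.
rewrite -Rintegral_kernel0_reflect0// -[X in m' * X](Rintegral_kernel0_reflect
  kappaP).
by apply: lerD; exact: le_Rintegral_kernel0M bf _.
Qed.

Lemma conv_ge_split f r t m m' : 0 <= r -> r <= t -> bounded_measurable t f ->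
  (forall s, 0 <= s <= r -> m <= f s) -> (forall s, r <= s <= t -> m' <= f s) ->
  m * (K t - K (t - r)) + m' * K (t - r) <= C f t.
Proof.
move=> r0 rt bf fm fm'.
have := conv_le_split _ r t (- m) (- m') r0 rt (bounded_measurableN _ _ bf).
rewrite convN// => h.
rewrite -lerN2 (le_trans (h _ _)) => [|s /fm|s /fm'|]; rewrite ?lerN2//.
by rewrite le_eqVlt; apply/orP; left; apply/eqP; ring.
Qed.

Lemma kernel_primitive0 : K 0 = 0.
Proof. by rewrite /kernel_primitive set_itv1 Rintegral_set1. Qed.

(** On the past [[0, r]] the kernel difference k (t - s) - k (r - s) is nonpositive, so a lower
    bound of f yields an upper bound of the integral; on [[r, t]] the kernel is nonnegative and an
    upper bound of f is used. *)
Lemma conv_increment_le f r t m m' : 0 <= r -> r <= t -> bounded_measurable t f ->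
  (forall s, 0 <= s <= r -> m <= f s) -> (forall s, r <= s <= t -> f s <= m') ->
  C f t - C f r <= m * (K t - K r - K (t - r)) + m' * K (t - r).
Proof.
move=> r0 rt bf fm fm'.
have bfr := bounded_measurableS _ _ _ rt bf.
have i1 := integrable_kernel0M _ _ _ _ _ (lexx 0) rt rt bf.
have i2 := integrable_kernel0M _ _ _ _ _ (lexx 0) (lexx r) (lexx r) bfr.
have bm := bounded_measurable_cst t m.
have bmr := bounded_measurable_cst r m.
have j1 := integrable_kernel0M _ _ _ _ _ (lexx 0) rt rt bm.
have j2 := integrable_kernel0M _ _ _ _ _ (lexx 0) (lexx r) (lexx r) bmr.
(* The end point s = r is removed: there [kernel0] takes its default value 0 at r - s, and the
   comparison k (t - s) <= k (r - s) may fail. *)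
have iS g : mu.-integrable `[0, r] (EFin \o g) -> mu.-integrable `[0, r[ (EFin \o g).
  by apply: integrableS => //; apply: subset_itvl; rewrite bnd_simp.
have H : \int[mu]_(s in `[0, r]) (k (t - s) * f s) - C f r <=
         \int[mu]_(s in `[0, r]) (k (t - s) * m) -
         \int[mu]_(s in `[0, r]) (k (r - s) * m).
  have i1' := iS _ i1.
  have i2' := iS _ i2.
  have j1' := iS _ j1.
  have j2' := iS _ j2.
  rewrite /conv -!Rintegral_itv_bndo_bndc//.
  rewrite -!RintegralB//; apply: le_Rintegral => //.
  - apply: (eq_integrable _ _ _ _ (integrableB _ i1' i2')) => //.
  - apply: (eq_integrable _ _ _ _ (integrableB _ j1' j2')) => //.
  move=> s; rewrite /= in_itv/= => /andP[s0 sr].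
  have k1 : k (t - s) <= k (r - s) by apply: kernel0_le => //; lra.
  have := fm s; rewrite s0 (ltW sr) => /(_ isT) fs.
  rewrite -subr_ge0 (_ : _ - _ = (k (r - s) - k (t - s)) * (f s - m)); last by ring.
  by apply: mulr_ge0; lra.
have E x : 0 <= x -> r <= x ->
    \int[mu]_(s in `[0, r]) (k (x - s) * m) = m * (K x - K (x - r)).
  move=> x0 rx; rewrite -Rintegral_kernel0_reflect0// -RintegralZl//.
    by apply: eq_Rintegral => s _; ring.
  apply: integrableS (integrable_kernel0_reflect kappaP 0 x) => //.
  by apply: subset_itvl; rewrite bnd_simp.
rewrite (E t) ?(le_trans r0)// (E r)// subrr in H.
rewrite (conv_split _ r t)//.
have H2 : \int[mu]_(s in `[r, t]) (k (t - s) * f s) <= m' * K (t - r).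
  rewrite -(Rintegral_kernel0_reflect kappaP).
  by apply: le_Rintegral_kernel0M bf _.
rewrite kernel_primitive0 in H;
  apply: le_trans (_ :
    _ <= m * (K t - K (t - r)) - m * (K r - 0) + m' * K (t - r)) _; first by lra.
by rewrite le_eqVlt; apply/orP; left; apply/eqP; ring.
Qed.

Lemma conv_increment_ge f r t m m' : 0 <= r -> r <= t -> bounded_measurable t f ->
  (forall s, 0 <= s <= r -> f s <= m) -> (forall s, r <= s <= t -> m' <= f s) ->
  m * (K t - K r - K (t - r)) + m' * K (t - r) <= C f t - C f r.
Proof.
move=> r0 rt bf fm fm'.
have := conv_increment_le _ r t (- m) (- m') r0 rt (bounded_measurableN _ _ bf).
rewrite !convN//; last exact: bounded_measurableS bf.
move=> h; rewrite -lerN2 (_ : - (_ - _) = - C f t - - C f r); last by ring.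
rewrite (le_trans (h _ _)) => [|s /fm|s /fm'|]; rewrite ?lerN2//.
by rewrite le_eqVlt; apply/orP; left; apply/eqP; ring.
Qed.

End Convolution.

(** * The primitive of the kernel and Gronwall's lemma *)

(** Takes the place of passages to the limit in the iterations below: if x were positive, a / x
    would dominate every power of 2. *)
Lemma le0_of_geometric_bound {R : realType} (x a : R) :
  (forall n, x <= a * 2^-1 ^+ n) -> x <= 0.
Proof.
move=> h; rewrite leNgt; apply/negP => x0.
have a0 : 0 <= a / x.
  by have := h 0%N; rewrite expr0 mulr1 => xa; apply: divr_ge0; lra.
have := h (Num.Def.archi_bound (a / x)); rewrite leNgt => /negP; apply.
have := archi_boundP a0; set n := Num.Def.archi_bound _ => an.
rewrite exprVn ltr_pdivrMr ?exprn_gt0// -ltr_pdivrMl// mulrC (lt_trans an)//.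
by rewrite -natrX ltr_nat ltn_expl.
Qed.

(** The sequences u n - 2 E 2^-n and u n + 2 E 2^-n are respectively nondecreasing and
    nonincreasing, so the supremum of the first lies between them for every n. *)
Lemma geometric_limit {R : realType} (u : nat -> R) (E : R) : 0 <= E ->
  (forall n, `|u n.+1 - u n| <= E * 2^-1 ^+ n) ->
  exists l, forall n, `|l - u n| <= 2 * E * 2^-1 ^+ n.
Proof.
move=> E0 h.
pose a n := u n + 2 * E * 2^-1 ^+ n; pose b n := u n - 2 * E * 2^-1 ^+ n.
have e0 n : 0 <= E * 2^-1 ^+ n :> R by rewrite mulr_ge0// exprn_ge0// invr_ge0.
have ab n : b n <= a n by rewrite /a /b; have := e0 n; lra.
have an n m : a (n + m)%N <= a n.
  elim: m => [|m IH]; first by rewrite addn0.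
  apply: le_trans IH; rewrite addnS /a exprS; have := h (n + m)%N.
  rewrite ler_norml => /andP[_]; set x := 2^-1 ^+ _; lra.
have bn n m : b n <= b (n + m)%N.
  elim: m => [|m IH]; first by rewrite addn0.
  apply: (le_trans IH); rewrite addnS /b exprS; have := h (n + m)%N.
  rewrite ler_norml => /andP[+ _]; set x := 2^-1 ^+ _; lra.
have ba n m : b n <= a m.
  apply: le_trans (bn n m) _; rewrite addnC.
  exact: le_trans (ab _) (an _ _).
have hs : has_sup (range b).
  by split; [exists (b 0%N); exists 0%N|exists (a 0%N) => _ [n _ <-]].
exists (sup (range b)) => n; rewrite ler_norml.
have h1 : b n <= sup (range b) by apply: ub_le_sup; [exact: hs.2|exists n].
have h2 : sup (range b) <= a n by apply: ge_sup; [exact: hs.1|move=> _ [m _ <-]].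
by move: h1 h2; rewrite /a /b => h1 h2; apply/andP; split; lra.
Qed.

Lemma within_continuous_uniform {R : realType} (S : R) (h : R -> R) :
  (forall e, 0 < e -> exists2 d, 0 < d & forall r t, 0 <= r -> r <= t -> t <= S ->
    t - r < d -> `|h t - h r| < e) ->
  {within `[0, S], continuous h}.
Proof.
move=> hS; apply/subspace_continuousP => x /=; rewrite in_itv/= => /andP[x0 xS].
apply/cvgrPdist_lt => e /hS[d d0 hd].
exists d => //= y /= + ; rewrite in_itv/= ltr_norml => /andP[h1 h2] /andP[y0 yS].
by have [xy|/ltW yx] := leP x y; [rewrite distrC|]; apply: hd => //; lra.
Qed.

Lemma within_continuousP {R : realType} (S x e : R) (h : R -> R) :
  {within `[0, S], continuous h} -> 0 <= x <= S -> 0 < e ->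
  exists2 d, 0 < d & forall y, 0 <= y <= S -> `|x - y| < d -> `|h x - h y| < e.
Proof.
move=> /subspace_continuousP ch xS e0.
have xS' : `[0, S]%classic x by rewrite /= in_itv.
have /cvgrPdist_lt/(_ _ e0)[d /= d0 hd] := ch x xS'.
by exists d => // y yS xy; apply: hd => //; rewrite /= in_itv.
Qed.

Section Kernel.
Context {R : realType} {kappa : R -> R}.
Hypothesis kappaP : admissible_kernel kappa.
Local Notation mu := (@lebesgue_measure R).
Local Notation K := (kernel_primitive kappa).
Local Notation C := (conv kappa).
Implicit Types (f g h : R -> R) (r s t S L M A B : R).

Lemma kernel_primitive_ge0 t : 0 <= K t.
Proof.
by rewrite kernel_primitiveE//; apply: Rintegral_ge0 => s _; exact: kernel0_ge0.
Qed.

Lemma kernel_primitive_le s t : 0 <= s -> s <= t -> K s <= K t.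
Proof.
move=> s0 st.
have := @Rintegral_kernel0_reflect0 _ _ kappaP (t - s) t.
rewrite (_ : t - (t - s) = s) => [h|]; last by ring.
rewrite -subr_ge0 -h ?subr_ge0//; last by lra.
by apply: Rintegral_ge0 => x _; exact: kernel0_ge0.
Qed.

(** The increment bound for f = 0, with -1 as lower bound on the past and 0 as upper bound
    afterwards, reads 0 <= - (K t - K r - K (t - r)). *)
Lemma kernel_primitive_subadd r t : 0 <= r -> r <= t -> K t - K r <= K (t - r).
Proof.
move=> r0 rt.
have b0 := bounded_measurable_cst t 0.
have := conv_increment_le kappaP (cst 0) r t (-1) 0 r0 rt b0.
have C0 s : C (cst 0) s = 0.
  rewrite /conv; under eq_Rintegral do rewrite mulr0.
  by rewrite Rintegral_cst//= mul0r.
by rewrite !C0 => H; have := H (fun s _ => ltW (ltrN10 R)) (fun s _ => lexx 0); lra.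
Qed.

(** Absolute continuity of the integral, for the kernel cut off at 1 to make it integrable on the
    whole line. For negative t the interval of integration is empty. *)
Lemma kernel_primitive_small e : 0 < e -> exists2 d, 0 < d & forall t, t <= d ->
  K t < e.
Proof.
move=> e0.
have ki : mu.-integrable setT (EFin \o (kernel0 kappa \_ `[0, 1])).
  rewrite -restrict_EFin; apply/integrable_restrict => //=.
  by rewrite setTI; exact: integrable_kernel0.
have [d [d0 /= kd]] := integral_normr_continuous ki e0.
have d10 : 0 < Num.min 1 (d / 2) by rewrite lt_min ltr01/= divr_gt0.
exists (Num.min 1 (d / 2)) => // t; rewrite le_min => /andP[t1 td].
have [t0|t0] := leP 0 t; last first.
  by rewrite /kernel_primitive set_itv_ge ?Rintegral_set0// bnd_simp -ltNge.
have := kd `[0, t]%classic (measurable_itv _).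
rewrite lebesgue_measure_itv/= => H.
rewrite kernel_primitiveE//; apply: le_lt_trans (H _).
  apply: le_Rintegral => //; first exact: integrable_kernel0.
    apply: (@integrable_norm _ _ _ mu).
    by apply: integrableS ki.
  move=> s; rewrite /= in_itv/= => /andP[s0 st].
  rewrite patchE mem_set ?ler_norm//=.
  by rewrite in_itv/= s0 (le_trans st).
by case: ifP => _; rewrite ?oppr0 ?adde0 lte_fin; lra.
Qed.

(** The increment bounds with constants -B and B; the remaining term B (K t - K r) has a favourable
    sign. Thus K is a common modulus of continuity for all convolutions of functions with a given
    bound. *)
Lemma conv_modulus f r t B : 0 <= r -> r <= t -> bounded_measurable t f ->
  (forall s, 0 <= s <= t -> `|f s| <= B) -> `|C f t - C f r| <= 2 * B * K (t - r).
Proof.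
move=> r0 rt bf fB.
have B0 : 0 <= B by apply: le_trans (fB 0 _) => //; rewrite lexx (le_trans r0).
have f1 s : 0 <= s <= r -> - B <= f s <= B.
  by move=> /andP[s0 sr]; rewrite -ler_norml fB// s0 (le_trans sr).
have f2 s : r <= s <= t -> - B <= f s <= B.
  by move=> /andP[s0 sr]; rewrite -ler_norml fB// sr (le_trans r0).
have := conv_increment_le kappaP f r t (- B) B r0 rt bf (fun s sr => proj1 (andP (f1
  s sr))) (fun s sr => proj2 (andP (f2 s sr))).
have := conv_increment_ge kappaP f r t B (- B) r0 rt bf (fun s sr => proj2 (andP (f1
  s sr))) (fun s sr => proj1 (andP (f2 s sr))).
have := kernel_primitive_le _ _ r0 rt.
have := kernel_primitive_subadd _ _ r0 rt.
set x := K t; set y := K r; set z := K (t - r) => h1 h2 h3 h4.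
have p : 0 <= B * (x - y) by apply: mulr_ge0; lra.
rewrite ler_norml; apply/andP; split; nra.
Qed.

Lemma conv0 f : C f 0 = 0.
Proof. by rewrite /conv set_itv1 Rintegral_set1. Qed.

Lemma conv_abs_le f g t : bounded_measurable t f -> bounded_measurable t g ->
  (forall s, 0 <= s <= t -> `|f s| <= g s) -> `|C f t| <= C g t.
Proof.
move=> bf bg fg; rewrite ler_norml -convN//; apply/andP; split; apply: le_conv => //.
- exact: bounded_measurableN.
- by move=> s /fg; rewrite ler_norml => /andP[].
- by move=> s /fg; rewrite ler_norml => /andP[].
Qed.

Lemma within_continuous_modulus S A h :
  (forall r t, 0 <= r -> r <= t -> t <= S -> `|h t - h r| <= A * K (t - r)) ->
  {within `[0, S], continuous h}.
Proof.
move=> hA; apply: within_continuous_uniform => e e0.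
have A0 : 0 < `|A| + 1 by rewrite ltr_wpDl.
have [d d0 Kd] := kernel_primitive_small (e / (`|A| + 1)) (divr_gt0 e0 A0).
exists d => // r t r0 rt tS trd; apply: le_lt_trans (hA _ _ r0 rt tS) _.
have K0 := kernel_primitive_ge0 (t - r).
apply: (@le_lt_trans _ _ ((`|A| + 1) * K (t - r))).
  by apply: ler_wpM2r => //; rewrite (le_trans (ler_norm A))// lerDl.
by rewrite mulrC -ltr_pdivlMr// Kd// ltW.
Qed.

Lemma bounded_measurable_continuous S h : {within `[0, S], continuous h} ->
  bounded_measurable S h.
Proof.
move=> ch; split.
  exact: subspace_continuous_measurable_fun.
have [S0|S0] := leP 0 S; last by exists 0 => s /andP[s0 sS]; lra.
have [c _ hc] := EVT_max S0 ch; have [c' _ hc'] := EVT_min S0 ch.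
exists (Num.max `|h c| `|h c'|) => s sS.
have sS' : s \in `[0, S]%R by rewrite in_itv.
rewrite ler_norml; apply/andP; split.
  rewrite lerNl le_max; apply/orP; right.
  by have := hc' _ sS'; have := ler_norm (- h c'); rewrite normrN; lra.
by rewrite le_max (le_trans (hc _ sS')) ?ler_norm.
Qed.

Lemma bounded_measurable_expR S M : bounded_measurable S (fun s => expR (M * s)).
Proof.
apply: bounded_measurable_continuous; apply: continuous_subspaceT => x.
apply: continuous_comp; first exact: mulrl_continuous.
exact: continuous_expR.
Qed.

(* The singular part of the kernel is absorbed by the smallness of K near 0,
   the rest by the exponential decay of the weight. *)
Lemma exponential_weight S L : 0 <= S -> 0 <= L -> exists2 M, 0 <= M &
  forall t, 0 <= t -> t <= S ->
    L * C (fun s => expR (M * s)) t <= 2^-1 * expR (M * t).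
Proof.
move=> S0 L0.
have L1 : 0 < 4 * (L + 1) by lra.
have [d d0 Kd] := kernel_primitive_small (4 * (L + 1))^-1 (ltac:(by rewrite
  invr_gt0)).
have KS := kernel_primitive_ge0 S.
(* With this M, exp (M d) >= 1 + M d >= 4 L K S, so the part of the convolution before t - d costs
   at most a quarter of exp (M t). The part after t - d costs another quarter, as L K d <= 1/4. *)
exists (4 * L * K S / d); first by rewrite divr_ge0 ?mulr_ge0// ltW.
set M := _ / d => t t0 tS.
have M0 : 0 <= M by rewrite divr_ge0 ?mulr_ge0// ltW.
have be := bounded_measurable_expR t M.
have mono x y : x <= y -> expR (M * x) <= expR (M * y).
  by move=> xy; rewrite ler_expR ler_wpM2l.
have LK x : x <= d -> L * K x <= 4^-1.
  move=> /Kd Kx; apply: (@le_trans _ _ ((L + 1) * (4 * (L + 1))^-1)).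
    by apply: ler_pM => //; [exact: kernel_primitive_ge0|lra|exact: ltW].
  by rewrite invfM mulrCA divff ?mulr1// lt0r_neq0//; lra.
have et : 0 < expR (M * t) by exact: expR_gt0.
have [td|dt] := leP t d.
  have := conv_le_split kappaP _ 0 t 1 (expR (M * t)) (lexx 0) t0 be.
  rewrite subr0 subrr mulr0 add0r => H.
  have {}H : C (fun s => expR (M * s)) t <= expR (M * t) * K t.
    apply: H => s /andP[s0 st]; last exact: mono.
    by rewrite (_ : s = 0) ?mulr0 ?expR0//; lra.
  apply: le_trans (ler_wpM2l L0 H) _; rewrite mulrCA mulrC.
  by apply: ler_wpM2r; [exact: ltW|have := LK _ td; lra].
have r0 : 0 <= t - d by lra.
have rt : t - d <= t by lra.
have := conv_le_split kappaP _ (t - d) t (expR (M * (t - d))) (expR (M * t)) r0 rt be.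
rewrite (_ : t - (t - d) = d) => [H|]; last by ring.
have {}H : C (fun s => expR (M * s)) t <=
    expR (M * (t - d)) * (K t - K d) + expR (M * t) * K d.
  by apply: H => s /andP[s0 st]; exact: mono.
apply: le_trans (ler_wpM2l L0 H) _; rewrite mulrDr.
have H1 : L * (expR (M * t) * K d) <= 4^-1 * expR (M * t).
  by rewrite mulrCA mulrC; apply: ler_wpM2r; [exact: ltW|exact: LK].
have H2 : L * (expR (M * (t - d)) * (K t - K d)) <= 4^-1 * expR (M * t).
  rewrite (_ : M * t = M * d + M * (t - d)); last by ring.
  rewrite expRD mulrCA [leLHS]mulrC [leRHS]mulrA.
  apply: ler_wpM2r; first exact: expR_ge0.
  have : 1 + M * d <= expR (M * d) by exact: expR_ge1Dx.
  rewrite /M divfK ?gt_eqF// -/M.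
  have : L * (K t - K d) <= L * K S.
    apply: ler_wpM2l => //; have := kernel_primitive_le _ _ t0 tS.
    by have := kernel_primitive_ge0 d; lra.
  by lra.
lra.
Qed.

(** Starting from h t <= B exp (M t), each use of the hypothesis halves the constant, by
    [exponential_weight]. *)
Lemma volterra_gronwall S L h : 0 <= L -> bounded_measurable S h ->
  (forall t, 0 <= t <= S -> h t <= L * C h t) ->
  forall t, 0 <= t <= S -> h t <= 0.
Proof.
move=> L0 bh hC t tS.
have S0 : 0 <= S by case/andP: tS => ? /(le_trans _); apply.
have [M M0 HM] := exponential_weight _ _ S0 L0.
have [_ [B hB]] := bh.
have B0 : 0 <= B by apply: le_trans (hB t tS).
suff H n : forall t, 0 <= t <= S -> h t <= B * 2^-1 ^+ n * expR (M * t).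
  by apply: (@le0_of_geometric_bound _ _ (B * expR (M * t))) => n; rewrite mulrAC;
    exact: H.
elim: n => {t tS} [|n IH] t tS.
  rewrite expr0 mulr1 (le_trans (ler_norm _))// (le_trans (hB _ tS))//.
  rewrite ler_peMr//; apply: le_trans (expR_ge1Dx _).
  by rewrite lerDl mulr_ge0//; case/andP: tS.
have /andP[t0 tS'] := tS.
apply: le_trans (hC t tS) _.
have be := bounded_measurable_expR t M.
pose c := B * 2^-1 ^+ n; have c0 : 0 <= c by rewrite mulr_ge0// exprn_ge0// invr_ge0.
have : C h t <= C (fun s => c * expR (M * s)) t.
  apply: le_conv => //; first exact: bounded_measurableS bh.
    exact: bounded_measurableZ.
  by move=> s /andP[s0 st]; apply: IH; rewrite s0 (le_trans st).
rewrite convZ// => H; apply: le_trans (ler_wpM2l L0 H) _.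
rewrite mulrCA (_ : B * _ * _ = c * (2^-1 * expR (M * t))); last by rewrite /c exprS;
  ring.
by apply: ler_wpM2l => //; exact: HM.
Qed.

(** Gronwall for the positive part of x - y. Keeping f and g abstract allows sub- and supersolutions
    of different equations, with a one-sided Lipschitz bound along x and y only. *)
Lemma volterra_comparison S L (x y : R -> R) f g : 0 <= L ->
  bounded_measurable S x -> bounded_measurable S y ->
  bounded_measurable S f -> bounded_measurable S g ->
  (forall t, 0 <= t <= S -> x t <= C f t) ->
  (forall t, 0 <= t <= S -> C g t <= y t) ->
  (forall s, 0 <= s <= S -> f s - g s <= L * Num.max 0 (x s - y s)) ->
  forall t, 0 <= t <= S -> x t <= y t.
Proof.
move=> L0 bx by_ bf bg xf yg fg t tS.
have bv : bounded_measurable S (fun s => Num.max 0 (x s - y s)).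
  apply: bounded_measurable_max0; apply: bounded_measurableD => //.
  exact: bounded_measurableN.
suff : Num.max 0 (x t - y t) <= 0.
  by rewrite ge_max => /andP[_]; rewrite subr_le0.
apply: (volterra_gronwall _ _ _ L0 bv _ _ tS) => {}t {}tS.
have /andP[t0 tS'] := tS.
have bvt := bounded_measurableS _ _ _ tS' bv.
have bft := bounded_measurableS _ _ _ tS' bf.
have bgt := bounded_measurableS _ _ _ tS' bg.
rewrite ge_max; apply/andP; split.
  apply: mulr_ge0 => //; apply: Rintegral_ge0 => s _; apply: mulr_ge0.
    exact: kernel0_ge0.
  by rewrite le_max lexx.
rewrite -convZ//; apply: le_trans (_ : C (fun s => f s + - g s) t <= _).
  rewrite convD ?convN//; last exact: bounded_measurableN.
  by apply: lerB; [exact: xf|exact: yg].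
apply: le_conv => //.
- by apply: bounded_measurableD => //; exact: bounded_measurableN.
- exact: bounded_measurableZ.
- by move=> s /andP[s0 st]; apply: fg; rewrite s0 (le_trans st).
Qed.

End Kernel.

(** * Existence, uniqueness and maximal solutions *)

Definition locally_lipschitz {R : realType} (F : R -> R) : Prop :=
  forall B, exists2 L, 0 <= L &
    forall x y, `|x| <= B -> `|y| <= B -> `|F x - F y| <= L * `|x - y|.

Lemma locally_lipschitz_continuous {R : realType} (F : R -> R) :
  locally_lipschitz F -> continuous F.
Proof.
move=> lF x; have [L L0 FL] := lF (`|x| + 1).
apply/cvgrPdist_lt => e e0.
have L1 : 0 < L + 1 by lra.
exists (Num.min 1 (e / (L + 1))); first by rewrite /= lt_min ltr01 divr_gt0.
move=> y /=; rewrite lt_min => /andP[xy1 xye].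
have y1 : `|y| <= `|x| + 1.
  by rewrite -(subrK x y) (le_trans (ler_normD _ _))// addrC lerD2l distrC ltW.
apply: le_lt_trans (FL x y _ y1) _; first by rewrite lerDl.
apply: (@le_lt_trans _ _ ((L + 1) * `|x - y|)); first by rewrite ler_wpM2r// lerDl.
by rewrite mulrC -ltr_pdivlMr.
Qed.

Lemma bounded_measurable_comp {R : realType} (F h : R -> R) S :
  locally_lipschitz F -> bounded_measurable S h ->
  bounded_measurable S (fun s => F (h s)).
Proof.
move=> lF [mh [B hB]]; split.
  apply: measurableT_comp => //; apply: continuous_measurable_fun.
  exact: locally_lipschitz_continuous.
have [L L0 FL] := lF `|B|.
exists (`|F 0| + L * `|B|) => s sS.
have hs : `|h s| <= `|B| by apply: le_trans (hB _ sS) (ler_norm _).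
rewrite -(subrK (F 0) (F (h s))) addrC (le_trans (ler_normD _ _))// lerD2l.
apply: le_trans (FL _ _ hs _) _; first by rewrite normr0.
by rewrite subr0 ler_wpM2l.
Qed.

(** Precomposition with this truncation makes a locally Lipschitz function bounded and globally
    Lipschitz. *)
Definition clamp {R : realType} (B x : R) : R := Num.max (- B) (Num.min x B).

Lemma clamp_abs {R : realType} (B x : R) : 0 <= B -> `|clamp B x| <= B.
Proof.
move=> B0; rewrite /clamp ler_norml; apply/andP; split.
  by rewrite le_max lexx.
by rewrite ge_max ge_min lexx orbT andbT; lra.
Qed.

Lemma clamp_id {R : realType} (B x : R) : `|x| <= B -> clamp B x = x.
Proof. by rewrite ler_norml /clamp => /andP[h1 h2]; rewrite min_l// max_r. Qed.

Lemma clamp_lipschitz {R : realType} (B x y : R) :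
  `|clamp B x - clamp B y| <= `|x - y|.
Proof.
have /andP[h1 h2] : - `|x - y| <= x - y <= `|x - y| by rewrite -ler_norml.
rewrite /clamp ler_norml.
by case: (leP x B) => ?; case: (leP y B) => ?;
  repeat match goal with |- context [Num.max ?a ?b] => case: (leP a b) => ? end;
  apply/andP; split; lra.
Qed.

Section Solutions.
Context {R : realType} {kappa : R -> R}.
Hypothesis kappaP : admissible_kernel kappa.
Local Notation mu := (@lebesgue_measure R).
Local Notation K := (kernel_primitive kappa).
Local Notation C := (conv kappa).
Implicit Types (F f g h psi phi : R -> R) (r s t S L M A B : R).

Lemma eq_conv f g t : (forall s, 0 <= s <= t -> f s = g s) -> C f t = C g t.
Proof.
by move=> fg; apply: eq_Rintegral => s; rewrite inE/= in_itv/= => /fg ->.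
Qed.

Lemma half_open_le (T : \bar R) s t : half_open T t -> 0 <= s -> s <= t ->
  half_open T s.
Proof. by move=> [t0 tT] s0 st; split => //; apply: (@le_lt_trans _ _ t%:E);
  rewrite ?lee_fin. Qed.

Lemma half_open_continuous (T : \bar R) psi t : half_open T t ->
  {within half_open T, continuous psi} -> {within `[0, t], continuous psi}.
Proof.
move=> Tt; apply: continuous_subspaceW => s /=; rewrite in_itv/= => /andP[s0 st].
exact: half_open_le Tt s0 st.
Qed.

(** The integrands with [kappa] and with [kernel0 kappa] can differ at s = t only, and F o psi is
    bounded on [[0, t]], so the extended-real integral is finite. *)
Lemma volterra_solutionP F (T : \bar R) psi : locally_lipschitz F ->
  {within half_open T, continuous psi} ->
  volterra_solution kappa F T psi <->
  forall t, half_open T t -> psi t = C (fun s => F (psi s)) t.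
Proof.
move=> lF cpsi.
have E t : half_open T t ->
    (\int[mu]_(s in `[0%R, t]) (kappa (t - s) * F (psi s))%R%:E =
     (C (fun s => F (psi s)) t)%:E)%E.
  move=> Tt.
  have bp := bounded_measurable_continuous _ _ (half_open_continuous _ _ _ Tt cpsi).
  have bF := bounded_measurable_comp _ _ _ lF bp.
  have ki := integrable_kernel0M kappaP _ _ _ _ _ (lexx 0) (lexx t) (lexx t) bF.
  have mk : measurable_fun (`]0, t[ :
    set R) (fun s => kernel0 kappa (t - s) * F (psi s)).
    have := measurable_int _ ki => /measurable_EFinP; apply: measurable_funS => //.
    by apply: subset_itvW.
  have kE : {in `]0, t[, forall s,
    kernel0 kappa (t - s) * F (psi s) = kappa (t - s) * F (psi s)}.
    by move=> s; rewrite in_itv/= /kernel0 subr_gt0 => /andP[_ ->].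
  rewrite /conv /Rintegral fineK; last exact: integrable_fin_num.
  apply: eq_integral_itv_bounded => //; last by move=> s st; rewrite kE.
  by apply: eq_measurable_fun mk => s; rewrite inE/= => st; exact: kE.
split => [[_ H] t Tt|H]; first by have := H t Tt; rewrite E// => -[].
by split => // t Tt; rewrite E// -H.
Qed.

Lemma volterra_unique F S psi phi : locally_lipschitz F ->
  bounded_measurable S psi -> bounded_measurable S phi ->
  (forall t, 0 <= t <= S -> psi t = C (fun s => F (psi s)) t) ->
  (forall t, 0 <= t <= S -> phi t = C (fun s => F (phi s)) t) ->
  forall t, 0 <= t <= S -> psi t = phi t.
Proof.
move=> lF bp bq pE qE t tS.
have bv : bounded_measurable S (fun s => `|psi s + - phi s|).
  by apply: bounded_measurable_norm; apply: bounded_measurableD => //;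
    exact: bounded_measurableN.
have [_ [B pB]] := bp; have [_ [B' qB]] := bq.
have [L L0 FL] := lF (Num.max B B').
suff : `|psi t - phi t| <= 0.
  by rewrite normr_le0 subr_eq0 => /eqP.
apply: (volterra_gronwall kappaP _ _ _ L0 bv _ _ tS) => {}t {}tS.
have /andP[t0 tS'] := tS.
have bFp := bounded_measurable_comp _ _ _ lF (bounded_measurableS _ _ _ tS' bp).
have bFq := bounded_measurable_comp _ _ _ lF (bounded_measurableS _ _ _ tS' bq).
have bvt := bounded_measurableS _ _ _ tS' bv.
rewrite pE// qE// -convN// -convD//; last exact: bounded_measurableN.
rewrite -convZ//; apply: conv_abs_le => //.
- by apply: bounded_measurableD => //; exact: bounded_measurableN.
- exact: bounded_measurableZ.
- move=> s /andP[s0 st].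
  have sS : 0 <= s <= S by rewrite s0 (le_trans st).
  by apply: FL; rewrite le_max ?pB ?qB// orbT.
Qed.

(** Picard iteration from 0: relative to the weight exp (M t), successive differences are halved at
    each step. Pointwise limits suffice, because all iterates share the modulus 2 A K. *)
Lemma volterra_exists F L A S : 0 <= S -> 0 <= L ->
  (forall x y, `|F x - F y| <= L * `|x - y|) -> (forall x, `|F x| <= A) ->
  exists phi, {within `[0, S], continuous phi} /\
    forall t, 0 <= t <= S -> phi t = C (fun s => F (phi s)) t.
Proof.
move=> S0 L0 FL FA.
have lF : locally_lipschitz F by move=> B; exists L.
have A0 : 0 <= A by apply: le_trans (FA 0).
pose u n := iter n (fun psi => C (fun s => F (psi s))) (cst 0).
have modC psi r t : bounded_measurable S psi -> 0 <= r -> r <= t -> t <= S ->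
    `|C (fun s => F (psi s)) t - C (fun s => F (psi s)) r| <= 2 * A * K (t - r).
  move=> bp r0 rt tS; apply: conv_modulus => //.
  by apply: bounded_measurable_comp => //; exact: bounded_measurableS bp.
have bu n : bounded_measurable S (u n).
  elim: n => [|n IH]; first exact: bounded_measurable_cst.
  apply: bounded_measurable_continuous.
  by apply: (within_continuous_modulus kappaP _ (2 * A)) => r t; exact: modC.
have bFu n t : t <= S -> bounded_measurable t (fun s => F (u n s)).
  by move=> tS; apply: bounded_measurable_comp => //;
    exact: bounded_measurableS (bu n).
have [M M0 HM] := exponential_weight kappaP _ _ S0 L0.
(* A bound for the first iterate, which is the convolution of the kernel with F 0. *)
pose E := A * K S.
have E0 : 0 <= E by apply: mulr_ge0 => //; exact: kernel_primitive_ge0.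
have e1 t : 0 <= t -> 1 <= expR (M * t).
  by move=> t0; apply: le_trans (expR_ge1Dx _); rewrite lerDl mulr_ge0.
have Cdiff (psi phi : R -> R) c t : 0 <= c -> 0 <= t <= S ->
    bounded_measurable S psi -> bounded_measurable S phi ->
    (forall s, 0 <= s <= S -> `|psi s - phi s| <= c * expR (M * s)) ->
    `|C (fun s => F (psi s)) t - C (fun s => F (phi s)) t| <= c * 2^-1 * expR (M * t).
  move=> c0 /andP[t0 tS] bp bq pq.
  have bFp := bounded_measurable_comp _ _ _ lF (bounded_measurableS _ _ _ tS bp).
  have bFq := bounded_measurable_comp _ _ _ lF (bounded_measurableS _ _ _ tS bq).
  have be := bounded_measurable_expR t M.
  rewrite -convN// -convD//; last exact: bounded_measurableN.
  apply: le_trans (_ : C (fun s => L * c * expR (M * s)) t <= _).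
    apply: conv_abs_le => //.
    - by apply: bounded_measurableD => //; exact: bounded_measurableN.
    - exact: bounded_measurableZ.
    - move=> s /andP[s0 st]; apply: le_trans (FL _ _) _.
      by rewrite -mulrA ler_wpM2l// pq// s0 (le_trans st).
  rewrite convZ// [L * c]mulrC -2!mulrA ler_wpM2l//; exact: HM.
have step n t : 0 <= t <= S -> `|u n.+1 t - u n t| <= E * expR (M * t) * 2^-1 ^+ n.
  elim: n t => [|n IH] t tS; have /andP[t0 tS'] := tS.
    rewrite expr0 mulr1 subr0 -[leLHS]subr0 -(normr0 R) -(conv0 (kappa :=
      kappa) (fun s => F (u 0%N s))).
    apply: (@le_trans _ _ E); last by rewrite ler_peMr// e1.
    have := conv_abs_le kappaP (fun s => F (u 0%N s))
      (fun s => A * cst 1 s) t (bFu 0%N _ tS').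
    rewrite conv0 normr0 subr0 => H; apply: le_trans (H _ _) _ => //.
    - by apply: bounded_measurableZ; exact: bounded_measurable_cst.
    - by move=> s _; rewrite /= mulr1.
    rewrite convZ//; last exact: bounded_measurable_cst.
    apply: ler_wpM2l => //.
    have b1 := bounded_measurable_cst t 1.
    have := conv_le_split kappaP (cst 1) 0 t 1 1 (lexx 0) t0 b1 (fun _ _ => lexx 1)
      (fun _ _ => lexx 1).
    rewrite subr0 subrr mulr0 add0r mul1r => /le_trans; apply.
    exact: kernel_primitive_le.
  have := Cdiff (u n.+1) (u n) (E * 2^-1 ^+ n) t.
  rewrite exprSr (_ : E * _ * 2^-1 * _ = E * expR (M * t) * (2^-1 ^+ n * 2^-1)); last
    by ring.
  apply => //; first by rewrite mulr_ge0// exprn_ge0// invr_ge0.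
  by move=> s sS; rewrite mulrAC; exact: IH.
have [phi phiP] : {phi : R -> R & forall t, 0 <= t <= S -> forall n,
    `|phi t - u n t| <= 2 * (E * expR (M * t)) * 2^-1 ^+ n}.
  apply: (@choice R R (fun t y => 0 <= t <= S ->
    forall n, `|y - u n t| <= 2 * (E * expR (M * t)) * 2^-1 ^+ n)) => t.
  have [tS|tS] := boolP (0 <= t <= S); last by exists 0 => tS'; case/negP: tS.
  have [l Hl] := geometric_limit (fun n => u n t) (E * expR (M * t))
    (mulr_ge0 E0 (expR_ge0 _)) (fun n => step n t tS).
  by exists l.
have eS t : 0 <= t <= S -> expR (M * t) <= expR (M * S).
  by move=> /andP[t0 tS]; rewrite ler_expR ler_wpM2l.
(* The limit inherits the common modulus of the iterates, whence its continuity. *)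
have phimod r t : 0 <= r -> r <= t -> t <= S -> `|phi t - phi r| <= 2 * A * K (t - r).
  move=> r0 rt tS; rewrite -subr_le0.
  apply: (@le0_of_geometric_bound _ _ (4 * (E * expR (M * S)))) => n.
  have rS : 0 <= r <= S by rewrite r0 (le_trans rt).
  have tS' : 0 <= t <= S by rewrite tS (le_trans r0).
  have g0 : 0 <= 2^-1 ^+ n.+1 :> R by rewrite exprn_ge0// invr_ge0.
  have := phiP t tS' n.+1; have := phiP r rS n.+1.
  have : `|u n.+1 t - u n.+1 r| <= 2 * A * K (t - r) by exact: modC.
  have : (E * expR (M * r)) * 2^-1 ^+ n.+1 <= (E * expR (M * S)) * 2^-1 ^+ n.+1.
    by rewrite ler_wpM2r// ler_wpM2l// eS.
  have : (E * expR (M * t)) * 2^-1 ^+ n.+1 <= (E * expR (M * S)) * 2^-1 ^+ n.+1.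
    by rewrite ler_wpM2r// ler_wpM2l// eS.
  have p0 : 0 <= (E * expR (M * S)) * 2^-1 ^+ n.+1
    by rewrite mulr_ge0// mulr_ge0// expR_ge0.
  have -> : 4 * (E * expR (M * S)) * 2^-1 ^+ n = 8 * ((E * expR (M * S)) * 2^-1 ^+
    n.+1).
    by rewrite exprS; field.
  move: p0; set a := E * expR (M * S); set b := E * expR (M * t); set c :=
    E * expR (M * r).
  rewrite !ler_norml => p0 h1 h2 /andP[h3 h4] /andP[h5 h6] /andP[h7 h8].
  rewrite lerBlDr ler_norml; apply/andP; split; lra.
have cphi : {within `[0, S], continuous phi}.
  exact: (within_continuous_modulus kappaP _ (2 * A)).
exists phi; split => // t tS.
have bphi := bounded_measurable_continuous _ _ cphi.
apply/eqP; rewrite -subr_eq0 -normr_le0.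
(* Both phi and the convolution of F o phi are compared with u (n + 1), the convolution of F o u n;
   each comparison costs half of the bound. *)
apply: (@le0_of_geometric_bound _ _ (2 * (E * expR (M * t)))) => n.
have c0 : 0 <= 2 * E * 2^-1 ^+ n by apply: mulr_ge0;
  [exact: mulr_ge0|rewrite exprn_ge0// invr_ge0].
have := Cdiff (u n) phi _ t c0 tS (bu n) bphi.
have H s : 0 <= s <= S -> `|u n s - phi s| <= 2 * E * 2^-1 ^+ n * expR (M * s).
  by move=> sS; rewrite distrC; have := phiP s sS n; congr (_ <= _); ring.
move=> /(_ H); have := phiP t tS n.+1; rewrite -/(u n.+1) exprS.
rewrite (_ : 2 * (E * expR (M * t)) * (2^-1 * 2^-1 ^+ n) = 2^-1 * (2 * (E * expR (M *
  t)) * 2^-1 ^+ n)); last by ring.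
rewrite (_ : 2 * E * 2^-1 ^+ n * 2^-1 * expR (M * t) = 2^-1 * (2 * (E * expR (M * t))
  * 2^-1 ^+ n)); last by ring.
rewrite (_ : u n.+1 t = C (fun s => F (u n s)) t)// !ler_norml.
by move=> /andP[h1 h2] /andP[h3 h4]; apply/andP; split; lra.
Qed.

(** If T were finite, the equation truncated at |B| + 1 would have a solution phi on [[0, T + 1]],
    equal to psi before T by uniqueness. By its modulus, phi stays within the truncation level up to
    T + e, so it solves the original equation there and extends psi. *)
Lemma maximal_bounded_global F (T : \bar R) psi B : locally_lipschitz F ->
  maximal_solution kappa F T psi -> (forall t, half_open T t -> `|psi t| <= B) ->
  T = +oo%E.
Proof.
move=> lF [T0 solpsi maxpsi] psiB.
case: T T0 solpsi maxpsi psiB => // T; rewrite lee_fin => T0 solpsi maxpsi psiB;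
  exfalso.
have {}psiB t : half_open T%:E t -> `|psi t| <= `|B|.
  by move=> /psiB /le_trans; apply; exact: ler_norm.
pose G x := F (clamp (`|B| + 1) x).
have B1 : 0 <= `|B| + 1 by rewrite addr_ge0.
have [L L0 FL] := lF (`|B| + 1).
have GL x y : `|G x - G y| <= L * `|x - y|.
  apply: le_trans (FL _ _ _ _) _; rewrite ?clamp_abs//.
  by rewrite ler_wpM2l// clamp_lipschitz.
pose A := `|F 0| + L * (`|B| + 1).
have GA x : `|G x| <= A.
  rewrite -(subrK (F 0) (G x)) addrC (le_trans (ler_normD _ _))// lerD2l.
  apply: le_trans (FL _ _ _ _) _; rewrite ?clamp_abs// ?normr0//.
  by rewrite subr0 ler_wpM2l// clamp_abs.
have lG : locally_lipschitz G by move=> ?; exists L.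
have T10 : 0 <= T + 1 by rewrite addr_ge0.
have [phi [cphi phiE]] := volterra_exists G L A (T + 1) T10 L0 GL GA.
have bphi := bounded_measurable_continuous _ _ cphi.
have cpsi := solpsi.1.
have psiE := (volterra_solutionP _ _ _ lF cpsi).1 solpsi.
have eq_psi t : half_open T%:E t -> psi t = phi t.
  move=> Tt; have [t0 tT] := Tt; rewrite lte_fin in tT.
  have bt := bounded_measurable_continuous _ _ (half_open_continuous _ _ _ Tt cpsi).
  have tT1 : t <= T + 1 by lra.
  apply: (volterra_unique G t psi phi lG bt (bounded_measurableS _ _ _ tT1 bphi)).
  - move=> s /andP[s0 st]; rewrite psiE; last exact: half_open_le Tt s0 st.
    apply: eq_conv => x /andP[x0 xs]; rewrite /G clamp_id//.
    apply: le_trans (psiB _ _) _; last by rewrite lerDl.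
    by apply: half_open_le Tt x0 _; exact: le_trans st.
  - by move=> s /andP[s0 st]; apply: phiE; rewrite s0 (le_trans st).
  - by rewrite t0 lexx.
have A0 : 0 <= A by apply: le_trans (GA 0).
have [d d0 Kd] := kernel_primitive_small kappaP (2 * A + 1)^-1 (ltac:(by rewrite
  invr_gt0; lra)).
pose e := Num.min 1 (d / 2).
have e0 : 0 < e by rewrite lt_min ltr01 divr_gt0.
have e1 : e <= 1 by rewrite ge_min lexx.
have ed : e <= d / 2 by rewrite ge_min lexx orbT.
have phiB t : half_open (T + e)%:E t -> `|phi t| <= `|B| + 1.
  move=> [t0]; rewrite lte_fin => tTe.
  have tT1 : t <= T + 1 by lra.
  (* As e <= d / 2, this point lies before T, where phi = psi, or else T = 0 and r = 0, where phi
     vanishes. *)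
  pose r := Num.max 0 (t - d).
  have r0 : 0 <= r by rewrite le_max lexx.
  have rt : r <= t by rewrite ge_max t0/= gerBl ltW.
  have phir : `|phi r| <= `|B|.
    have [rT|Tr] := ltP r T; first by rewrite -eq_psi ?psiB//; split;
      rewrite ?lte_fin.
    have -> : r = 0 by move: Tr; rewrite /r; case: (leP 0 (t - d)) => //; lra.
    by rewrite phiE ?lexx// conv0 normr0.
  have rd : t - r <= d by rewrite lerBlDr -lerBlDl le_max lexx orbT.
  have : `|phi t - phi r| <= 1.
    have tS : 0 <= t <= T + 1 by rewrite t0.
    have rS : 0 <= r <= T + 1 by rewrite r0 (le_trans rt).
    rewrite (phiE t)// (phiE r)//.
    apply: le_trans (conv_modulus kappaP _ r t A r0 rt _ _) _ => //.
      by apply: bounded_measurable_comp => //; exact: bounded_measurableS bphi.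
    have := Kd _ rd; have := kernel_primitive_ge0 kappaP (t - r).
    set x := K _ => x0; rewrite -div1r ltr_pdivlMr; last by lra.
    by nra.
  by rewrite -{2}(subrK (phi r) (phi t)) => h; apply: le_trans (ler_normD _ _) _; lra.
apply: (maxpsi (T + e)%:E phi); first by rewrite lte_fin ltrDl.
  apply/volterra_solutionP => //.
    apply: continuous_subspaceW cphi => t [t0]; rewrite lte_fin /= in_itv/= t0 => h.
    by rewrite /=; lra.
  move=> t Te; have [t0] := Te; rewrite lte_fin => tT.
  rewrite phiE; last by rewrite t0/=; lra.
  apply: eq_conv => s /andP[s0 st]; rewrite /G clamp_id// phiB//.
  exact: half_open_le Te s0 st.
by move=> t; rewrite inE => /eq_psi.
Qed.

End Solutions.

(** * Behaviour at running maxima *)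

(** The time is the infimum of the set where d >= 0. Continuity from the left excludes a positive
    value there, continuity from the right a negative one. *)
Lemma first_hitting_time {R : realType} (t : R) (d : R -> R) : 0 <= t ->
  {within `[0, t], continuous d} -> d 0 < 0 -> 0 <= d t ->
  exists s, [/\ 0 < s, s <= t, d s = 0 & forall x, 0 <= x -> x < s -> d x < 0].
Proof.
move=> t0 cd d0 dt.
pose B := [set s | 0 <= s <= t /\ 0 <= d s].
have Bt : B t by split; rewrite ?t0 ?lexx.
have Blb : lbound B 0 by move=> s [/andP[]].
have hB : has_inf B by split; [exists t|exists 0].
have s0 : 0 <= inf B by apply: lb_le_inf => //; exists t.
have st : inf B <= t by apply: ge_inf => //; exists 0.
have lo x : 0 <= x -> x < inf B -> d x < 0.
  move=> x0 xs; rewrite ltNge; apply/negP => dx.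
  have : inf B <= x; last by lra.
  by apply: ge_inf; [exists 0|split => //; rewrite x0 ltW// (lt_le_trans xs)].
have sS : 0 <= inf B <= t by rewrite s0.
have ds : d (inf B) = 0.
  apply/eqP; rewrite eq_le; apply/andP; split; rewrite leNgt; apply/negP => ds.
    have [x x0 dx] := within_continuousP _ _ _ _ cd sS ds.
    have [s1|s1] := ltP 0 (inf B); last by move: ds; rewrite (_ : inf B = 0); lra.
    pose y := Num.max 0 (inf B - x / 2).
    have y0 : 0 <= y by rewrite le_max lexx.
    have ys : y < inf B by rewrite gt_max s1/=; lra.
    have yx : inf B - x / 2 <= y by rewrite le_max lexx orbT.
    have yt : 0 <= y <= t by rewrite y0; lra.
    have sy : `|inf B - y| < x by rewrite ltr_norml; apply/andP; split; lra.
    by have := lo _ y0 ys; have := dx y yt sy; rewrite ltr_norml => /andP[]; lra.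
  have ds' : 0 < - d (inf B) by lra.
  have [x x0 dx] := within_continuousP _ _ _ _ cd sS ds'.
  have : inf B + x <= inf B; last by lra.
  apply: lb_le_inf; first by exists t.
  move=> y [yt dy]; rewrite leNgt; apply/negP => yx.
  have ys : inf B <= y by apply: ge_inf => //; exists 0.
  have := dx y yt; rewrite !ltr_norml => H.
  have /H/andP[] : - x < inf B - y < x by apply/andP; split; lra.
  by lra.
exists (inf B); split => //; rewrite lt_neqAle s0 andbT; apply/eqP => e0.
by move: ds; rewrite -e0; lra.
Qed.

Section ClosedSolutions.
Context {R : realType} {kappa : R -> R}.
Hypothesis kappaP : admissible_kernel kappa.
Local Notation K := (kernel_primitive kappa).
Local Notation C := (conv kappa).
Implicit Types (F f g h psi phi : R -> R) (r s t S L M A B w q : R).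

(** On a compact interval psi and F o psi are bounded, which need not hold on the half-open interval
    of existence. *)
Definition solution_on (kap F : R -> R) (S : R) (psi : R -> R) : Prop :=
  {within `[0, S], continuous psi} /\
  forall t, 0 <= t <= S -> psi t = conv kap (fun s => F (psi s)) t.

Lemma solution_onS F S psi t : t <= S ->
  solution_on kappa F S psi -> solution_on kappa F t psi.
Proof.
move=> tS [cpsi E]; split.
  by apply: continuous_subspaceW cpsi; apply: subset_itvl; rewrite bnd_simp.
by move=> s /andP[s0 st]; apply: E; rewrite s0 (le_trans st).
Qed.

Lemma volterra_solution_on F (T : \bar R) psi t : locally_lipschitz F ->
  volterra_solution kappa F T psi -> half_open T t -> solution_on kappa F t psi.
Proof.
move=> lF sol Tt; have cpsi := sol.1; split; first exact: half_open_continuous cpsi.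
move=> s /andP[s0 st]; apply: (volterra_solutionP kappaP _ _ _ lF cpsi).1 => //.
exact: half_open_le Tt s0 st.
Qed.

Lemma solution_on_bounded F S psi : locally_lipschitz F ->
  solution_on kappa F S psi ->
  bounded_measurable S psi /\ bounded_measurable S (fun s => F (psi s)).
Proof.
move=> lF [cpsi _]; have bp := bounded_measurable_continuous _ _ cpsi.
by split => //; exact: bounded_measurable_comp.
Qed.

Lemma conv_cst0 t : C (cst 0) t = 0.
Proof.
have := convZ kappaP (cst 0) 0 t (bounded_measurable_cst t 0).
by rewrite mul0r => E; rewrite -[RHS]E; apply: eq_conv => s _; rewrite mul0r.
Qed.

(** By subadditivity, K d <= 0 would propagate to all multiples of d, hence to t. *)
Lemma kernel_primitive_gt0 t d : 0 < K t -> 0 < d -> 0 < K d.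
Proof.
move=> Kt d0; rewrite ltNge; apply/negP => Kd.
have t0 : 0 <= t.
  rewrite leNgt; apply/negP => t0; move: Kt.
  by rewrite /kernel_primitive set_itv_ge ?Rintegral_set0 ?ltxx// bnd_simp -ltNge.
have H n : K (n%:R * d) <= 0.
  elim: n => [|n IH]; first by rewrite mul0r kernel_primitive0.
  have nd : 0 <= n%:R * d by rewrite mulr_ge0// ltW.
  have := kernel_primitive_subadd kappaP (n%:R * d) (n.+1%:R * d) nd.
  rewrite (_ : n.+1%:R * d - n%:R * d = d); last by rewrite -natr1; ring.
  by rewrite ler_pM2r// ler_nat leqnSn => /(_ isT); lra.
have := archi_boundP (divr_ge0 t0 (ltW d0)); set n := Num.Def.archi_bound _.
rewrite ltr_pdivrMr// => tn.
by have := kernel_primitive_le kappaP _ _ t0 (ltW tn); have := H n; lra.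
Qed.

(* Taking r as a minimizer of psi just before a running maximum t, the singular
   part of the kernel only contributes a small fraction of psi t - psi r. *)
Lemma increment_at_running_max F psi t q : locally_lipschitz F -> 0 < t -> 0 < q ->
  solution_on kappa F t psi ->
  (forall s, 0 <= s -> s < t -> psi s < psi t) ->
  (forall s, 0 <= s <= t -> F (psi t) <= F (psi s)) ->
  exists r, [/\ 0 <= r, r < t, psi r < psi t &
    (1 - q) * (psi t - psi r) <= F (psi t) * (K t - K r)].
Proof.
move=> lF t0 q0 sol pmax Fmin.
have [bp bF] := solution_on_bounded _ _ _ lF sol.
have [cpsi psiE] := sol.
have [_ [B pB]] := bp.
have [L L0 FL] := lF B.
have L1 : 0 < L + 1 by lra.
(* Chosen so that L K (t - r) <= q as soon as t - r <= d0. *)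
have [d0 d00 Kd0] := kernel_primitive_small kappaP (q / (L + 1)) (divr_gt0 q0 L1).
pose d := Num.min d0 t.
have d_gt0 : 0 < d by rewrite lt_min d00.
have dt : d <= t by rewrite ge_min lexx orbT.
have dd0 : d <= d0 by rewrite ge_min lexx.
have cd : {within `[t - d, t], continuous psi}.
  by apply: continuous_subspaceW cpsi; apply: subset_itvr; rewrite bnd_simp; lra.
have tdt : t - d <= t by lra.
have [r] := EVT_min tdt cd; rewrite in_itv/= => /andP[tr rt] rmin.
have r0 : 0 <= r by lra.
have prt : psi r < psi t.
  apply: le_lt_trans (_ : psi (t - d) < _); last by apply: pmax; lra.
  by apply: rmin; rewrite in_itv/= lexx.
have {}rt : r < t.
  by rewrite lt_neqAle rt andbT; apply/eqP => e; move: prt; rewrite e ltxx.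
exists r; split => //.
have rt' := ltW rt.
have pt s : 0 <= s -> s <= t -> psi s <= psi t.
  by move=> s0; rewrite le_eqVlt => /predU1P[->//|st]; apply/ltW/pmax.
(* On [[r, t]] one has psi r <= psi s <= psi t, whence the Lipschitz upper bound. The terms F (psi
   t) K (t - r) cancel, which leaves the error L (psi t - psi r) K (t - r), at most q (psi t - psi
   r). *)
have := conv_increment_le kappaP (fun s => F (psi s)) r t (F (psi t))
  (F (psi t) + L * (psi t - psi r)) r0 rt' bF.
rewrite -(psiE t) ?lexx ?(ltW t0)// -(psiE r) ?r0// => H.
have {}H : psi t - psi r <= F (psi t) * (K t - K r - K (t - r)) +
    (F (psi t) + L * (psi t - psi r)) * K (t - r).
  apply: H => s /andP[h1 h2]; first by apply: Fmin; rewrite h1 (le_trans h2).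
  have s0 : 0 <= s by lra.
  have sB : `|psi s| <= B by apply: pB; rewrite s0.
  have tB : `|psi t| <= B by apply: pB; rewrite lexx ltW.
  have := FL _ _ sB tB; rewrite ler_norml => /andP[_].
  rewrite distrC ger0_norm ?subr_ge0 ?pt//.
  have : L * (psi t - psi s) <= L * (psi t - psi r).
    apply: ler_wpM2l => //; rewrite lerD2l lerN2; apply: rmin.
    by rewrite in_itv/= h2 (le_trans tr).
  by lra.
have LK : L * K (t - r) <= q.
  have trd : t - r <= d0 by lra.
  have /ltW := Kd0 _ trd => /(ler_wpM2l L0) /le_trans; apply.
  by rewrite mulrCA -{2}(mulr1 q) ler_pM2l// ler_pdivrMr//; lra.
have : (psi t - psi r) * (L * K (t - r)) <= (psi t - psi r) * q.
  by apply: ler_wpM2l => //; lra.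
by lra.
Qed.

(** Comparison with the zero function: where psi is negative, F (psi s) >= F 0 - L |psi s| >= - L
    |psi s|. *)
Lemma solution_on_ge0 F psi S : locally_lipschitz F -> 0 <= F 0 ->
  solution_on kappa F S psi ->
  (forall s, 0 <= s <= S -> 0 <= psi s -> 0 <= F (psi s)) ->
  forall t, 0 <= t <= S -> 0 <= psi t.
Proof.
move=> lF F0 sol Fp.
have [bp bF] := solution_on_bounded _ _ _ lF sol.
have [_ [B pB]] := bp.
have [L L0 FL] := lF B.
have b0 := bounded_measurable_cst S 0.
apply: (volterra_comparison kappaP S L (cst 0) psi (cst 0)
  (fun s => F (psi s))) => //.
- by move=> t _; rewrite conv_cst0.
- by move=> t tS; rewrite -(sol.2 t tS).
move=> s sS; have [p0|p0] := leP 0 (psi s).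
  have : 0 <= L * Num.max 0 (cst 0 s - psi s) by rewrite mulr_ge0// le_max lexx.
  by have := Fp s sS p0; rewrite /=; lra.
rewrite /= max_r; last by lra.
have B0 : 0 <= B by apply: le_trans (pB s sS).
have := FL _ _ (pB s sS) (ltac:(by rewrite normr0) : `|0 : R| <= B).
by rewrite subr0 ler_norml ltr0_norm// => /andP[h _]; lra.
Qed.

(** At a first time where psi = w, the running-maximum estimate has right-hand side F w (K x - K r)
    = 0, against psi r < w. Nonnegativity is first proved up to that time only, since the sign of F
    is known on [[0, w]] alone. *)
Lemma solution_on_lt F psi S w : locally_lipschitz F -> 0 < w -> F w = 0 ->
  (forall x, 0 <= x <= w -> 0 <= F x) -> solution_on kappa F S psi ->
  forall t, 0 <= t <= S -> 0 <= psi t < w.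
Proof.
move=> lF w0 Fw Fp sol t tS; have /andP[t0 tS'] := tS.
have F0 : 0 <= F 0 by apply: Fp; rewrite lexx ltW.
have {}sol := solution_onS _ _ _ _ tS' sol.
have pw s : 0 <= s <= t -> psi s < w.
  move=> st; have /andP[s0 st'] := st.
  rewrite ltNge; apply/negP => ws.
  have {}sol := solution_onS _ _ _ _ st' sol.
  have cd : {within `[0, s], continuous (fun x => psi x - w)}.
    by move=> x; apply: cvgB; [exact: sol.1|exact: cvg_cst].
  have p0 : psi 0 = 0 by rewrite sol.2 ?lexx// conv0.
  have [] := first_hitting_time s _ s0 cd; rewrite ?p0; [lra|lra|].
  move=> x [x0 xs px plt].
  have {}sol := solution_onS _ _ _ _ xs sol.
  have {}px : psi x = w by lra.
  have plt' y : 0 <= y <= x -> psi y <= w.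
    move=> /andP[y0]; rewrite le_eqVlt => /predU1P[->|yx]; first by rewrite px.
    by have := plt _ y0 yx; lra.
  have ge0 : forall y, 0 <= y <= x -> 0 <= psi y.
    apply: (solution_on_ge0 _ _ _ lF F0 sol) => y yx py.
    by apply: Fp; rewrite py plt'.
  have q0 : 0 < 2^-1 :> R by rewrite invr_gt0.
  have pmax y : 0 <= y -> y < x -> psi y < psi x.
    by move=> y0 yx; have := plt _ y0 yx; lra.
  have Fmin y : 0 <= y <= x -> F (psi x) <= F (psi y).
    by move=> yx; rewrite px Fw; apply: Fp; rewrite ge0// plt'.
  have [r [_ _ prx]] := increment_at_running_max F psi x 2^-1 lF x0 q0 sol pmax Fmin.
  by rewrite px Fw mul0r; lra.
rewrite pw ?t0 ?lexx// andbT.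
apply: (solution_on_ge0 _ _ _ lF F0 sol); last by rewrite t0 lexx.
by move=> s st ps; apply: Fp; rewrite ps ltW// pw.
Qed.

(** If psi t were 0, F o psi would exceed F 0 / 2 just before t, on an interval that carries the
    positive kernel mass K (t - r). *)
Lemma solution_on_gt0 F psi t : locally_lipschitz F -> 0 < F 0 -> 0 <= t ->
  solution_on kappa F t psi -> (forall s, 0 <= s <= t -> 0 <= F (psi s)) ->
  0 < K t -> 0 < psi t.
Proof.
move=> lF F0 t0 sol Fp Kt.
have [bp bF] := solution_on_bounded _ _ _ lF sol.
have [cpsi psiE] := sol.
have tt : 0 <= t <= t by rewrite t0 lexx.
have low r m : 0 <= r -> r <= t -> (forall s, r <= s <= t -> m <= F (psi s)) ->
    m * K (t - r) <= psi t.
  move=> r0 rt Fm.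
  have := conv_ge_split kappaP (fun s => F (psi s)) r t 0 m r0 rt bF.
  rewrite -psiE// mul0r add0r; apply => // s /andP[s0 sr].
  by apply: Fp; rewrite s0 (le_trans sr).
have p0 : 0 <= psi t.
  by have := low 0 0 (lexx 0) t0 Fp; rewrite mul0r.
rewrite lt_neqAle p0 andbT; apply/eqP => pt.
have cF : {within `[0, t], continuous (fun s => F (psi s))}.
  by move=> x; apply: continuous_comp;
    [exact: cpsi|exact: locally_lipschitz_continuous].
have F2 : 0 < F 0 / 2 by lra.
have [d d0 Fd] := within_continuousP _ _ _ _ cF tt F2.
pose r := Num.max 0 (t - d / 2).
have r0 : 0 <= r by rewrite le_max lexx.
have rd : t - d / 2 <= r by rewrite le_max lexx orbT.
have rt : r <= t by rewrite ge_max t0/=; lra.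
have tpos : 0 < t.
  rewrite lt_neqAle t0 andbT; apply/eqP => e; move: Kt.
  by rewrite -e kernel_primitive0 ltxx.
have rt' : r < t by rewrite gt_max tpos/=; lra.
have := low r (F 0 / 2) r0 rt; rewrite -pt.
have Ktr : 0 < K (t - r) by apply: kernel_primitive_gt0 Kt _; rewrite subr_gt0.
have := mulr_gt0 F2 Ktr => h1 h2.
suff : F 0 / 2 * K (t - r) <= 0 by lra.
apply: h2 => s /andP[rs st].
have sS : 0 <= s <= t by rewrite st (le_trans r0).
have := Fd s sS; rewrite -pt ltr_norml => H.
have /H : - d < t - s < d by apply/andP; split; lra.
by rewrite ltr_norml => /andP[]; lra.
Qed.

End ClosedSolutions.

(** * Comparison with the ordinary differential equation *)

Section ConstKernel.
Context {R : realType}.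
Local Notation mu := (@lebesgue_measure R).
Implicit Types (F psi : R -> R) (a b t S m : R).

Lemma kernel_primitive_const t : 0 <= t -> kernel_primitive const_kernel t = t.
Proof.
move=> t0; rewrite /kernel_primitive Rintegral_cst//= lebesgue_measure_itv/= lte_fin
  mul1r.
case: ifP => [_|]; first by rewrite oppr0 adde0.
by move=> /negbT; rewrite -leNgt => t0'; apply/eqP; rewrite eq_le/= t0' t0.
Qed.

Lemma admissible_const_kernel : admissible_kernel (@const_kernel R).
Proof.
split; first by split => // *; rewrite /const_kernel.
move=> T T0; rewrite (eq_integral (cst 1%E))// integral_cst//= lebesgue_measure_itv/=
  lte_fin T0.
by rewrite oppr0 adde0 mul1e ltry.
Qed.

(** Plays the role of the mean value theorem. Since K t = t, the factor K b - K a - K (b - a)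
    vanishes and any bound B on the past will do. *)
Lemma ode_increment F psi S a b m m' : locally_lipschitz F ->
  solution_on const_kernel F S psi -> 0 <= a -> a <= b -> b <= S ->
  (forall x, a <= x <= b -> m <= F (psi x) <= m') ->
  m * (b - a) <= psi b - psi a <= m' * (b - a).
Proof.
move=> lF sol a0 ab bS Fm.
have {}sol := solution_onS _ _ _ _ bS sol.
have [_ bF] := solution_on_bounded _ _ _ lF sol.
have [_ [B FB]] := bF.
have b0 : 0 <= b by exact: le_trans ab.
have ba : 0 <= b - a by rewrite subr_ge0.
have FB' s : 0 <= s <= a -> - B <= F (psi s) <= B.
  by move=> /andP[s0 sa]; rewrite -ler_norml FB// s0 (le_trans sa).
have kP := admissible_const_kernel.
have := conv_increment_le kP (fun s => F (psi s)) a b (- B) m' a0 ab bF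
  (fun s sa => proj1 (andP (FB' s sa))) (fun s sb => proj2 (andP (Fm s sb))).
have := conv_increment_ge kP (fun s => F (psi s)) a b B m a0 ab bF
  (fun s sa => proj2 (andP (FB' s sa))) (fun s sb => proj1 (andP (Fm s sb))).
rewrite !kernel_primitive_const// subrr !mulr0 !add0r -!sol.2 ?lexx ?b0 ?a0//.
by move=> -> ->.
Qed.

End ConstKernel.

Section Comparison.
Context {R : realType} {kappa : R -> R}.
Hypothesis kappaP : admissible_kernel kappa.
Local Notation K := (kernel_primitive kappa).
Local Notation C := (conv kappa).
Implicit Types (F G psi : R -> R) (r s t S w : R).

(* The comparison function psi1 (e + (1 + e) * K s + e * s) starts above psi and
   grows strictly faster than psi can at a running maximum. *)
Lemma solution_le_ode F w psi psi1 S : locally_lipschitz F -> 0 < w -> F w = 0 ->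
  (forall x, 0 <= x < w -> 0 < F x) ->
  (forall x y, 0 <= x -> x <= y -> y <= w -> F y <= F x) ->
  solution_on kappa F S psi ->
  (forall t, 0 <= t -> solution_on const_kernel F t psi1) ->
  forall t, 0 <= t <= S -> psi t <= psi1 (K t).
Proof.
move=> lF w0 Fw Fpos Fdec sol sol1 t tS.
have /andP[t0 tS'] := tS.
have Fge x : 0 <= x <= w -> 0 <= F x.
  move=> /andP[x0]; rewrite le_eqVlt => /predU1P[->|xw]; first by rewrite Fw.
  by apply/ltW/Fpos; rewrite x0.
have {}sol := solution_onS _ _ _ _ tS' sol.
have pw s : 0 <= s <= t -> 0 <= psi s < w by exact: solution_on_lt sol s.
have p1w x : 0 <= x -> 0 <= psi1 x < w.
  move=> x0; apply: (solution_on_lt admissible_const_kernel F psi1 x w lF w0 Fw Fge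
    (sol1 x x0)).
  by rewrite x0 lexx.
have K0 := kernel_primitive_ge0 kappaP.
have mono a b : 0 <= a -> a <= b -> psi1 a <= psi1 b.
  move=> a0 ab; have b0 : 0 <= b by exact: le_trans ab.
  have [_ [_ [B FB]]] := solution_on_bounded _ _ _ lF (sol1 b b0).
  have := ode_increment F psi1 b a b 0 B lF (sol1 b b0) a0 ab (lexx b).
  case/(_ _)/andP => [x /andP[ax xb]|]; last by rewrite mul0r subr_ge0.
  have x0 : 0 <= x by exact: le_trans ax.
  have /andP[h1 h2] := p1w x x0.
  rewrite Fge ?h1 ?(ltW h2)//=; apply: le_trans (ler_norm _) _.
  by apply: FB; rewrite x0.
have inc a b : 0 <= a -> a <= b ->
    F (psi1 b) * (b - a) <= psi1 b - psi1 a <= F 0 * (b - a).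
  move=> a0 ab; have b0 : 0 <= b by exact: le_trans ab.
  apply: (ode_increment F psi1 b a b) => //; first exact: sol1.
  move=> x /andP[ax xb]; have x0 : 0 <= x by exact: le_trans ax.
  have /andP[h1 h2] := p1w x x0; have /andP[h3 h4] := p1w b b0.
  by apply/andP; split; apply: Fdec => //; [exact: mono|exact: ltW|exact: ltW].
have A0 : 0 < F 0 by apply: Fpos; rewrite lexx.
rewrite leNgt; apply/negP => lt_psi.
have D0 : 0 < F 0 * (1 + K t + t) by rewrite mulr_gt0//; have := K0 t; lra.
(* Chosen so that F 0 (l t - K t) is exactly the assumed gap: as psi1 has slope at most F 0, the
   accelerated copy has not overtaken psi at time t. *)
pose e := (psi t - psi1 (K t)) / (F 0 * (1 + K t + t)).
have e0 : 0 < e by rewrite divr_gt0// subr_gt0.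
have eE : F 0 * (e * (1 + K t + t)) = psi t - psi1 (K t).
  by rewrite /e; field; rewrite !gt_eqF//; have := K0 t; lra.
pose l s := e + (1 + e) * K s + e * s.
have l_le a b : 0 <= a -> a <= b -> l a <= l b.
  move=> a0 ab; rewrite /l; have := kernel_primitive_le kappaP _ _ a0 ab => h.
  by rewrite lerD ?lerD ?ler_wpM2l//; lra.
have l_ge a : 0 <= a -> 0 <= l a.
  move=> a0; have := mulr_ge0 (ltW e0) a0; have := mulr_ge0 (ltW e0) (K0 a).
  by have := K0 a; rewrite /l; lra.
have cl : {within `[0, t], continuous (fun s => psi1 (l s))}.
  apply: within_continuous_uniform => z z0.
  have n1 : 0 < 2 * (F 0 * (1 + e)) by apply: mulr_gt0 => //; apply: mulr_gt0 => //;
    lra.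
  have n2 : 0 < 2 * (F 0 * e) by apply: mulr_gt0 => //; exact: mulr_gt0.
  have q1 := divr_gt0 z0 n1; have q2 := divr_gt0 z0 n2.
  have [d d0 Kd] := kernel_primitive_small kappaP _ q1.
  exists (Num.min d (z / (2 * (F 0 * e)))); first by rewrite lt_min d0 q2.
  move=> a b a0 ab bt; rewrite lt_min => /andP[/ltW/Kd bad baz].
  have b0 := le_trans a0 ab.
  have /andP[h1 h2] := inc _ _ (l_ge a a0) (l_le a b a0 ab).
  have h3 := mono _ _ (l_ge a a0) (l_le a b a0 ab).
  rewrite ger0_norm ?subr_ge0//; apply: le_lt_trans h2 _.
  have h4 := kernel_primitive_subadd kappaP _ _ a0 ab.
  have {}bad : K (b - a) * (2 * (F 0 * (1 + e))) < z.
    by rewrite -ltr_pdivlMr.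
  have {}baz : (b - a) * (2 * (F 0 * e)) < z by rewrite -ltr_pdivlMr.
  have h5 : F 0 * (1 + e) * (K b - K a) <= F 0 * (1 + e) * K (b - a).
    by rewrite ler_wpM2l// mulr_ge0//; lra.
  by rewrite /l; lra.
have cd : {within `[0, t], continuous (fun s => psi s - psi1 (l s))}.
  by move=> x; apply: cvgB; [exact: sol.1|exact: cl].
have d0 : psi 0 - psi1 (l 0) < 0.
  have ps0 : psi 0 = 0 by rewrite sol.2 ?lexx// conv0.
  have l0 : l 0 = e by rewrite /l kernel_primitive0; ring.
  have p0 : psi1 0 = 0 by rewrite (sol1 0 (lexx _)).2 ?lexx// conv0.
  have /andP[h _] := inc 0 e (lexx 0) (ltW e0).
  rewrite ps0 l0 sub0r oppr_lt0; apply: lt_le_trans (_ : F (psi1 e) * e <= _).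
    by rewrite mulr_gt0// Fpos// p1w// ltW.
  by move: h; rewrite p0 !subr0.
have dt : 0 <= psi t - psi1 (l t).
  have lt_ : K t <= l t by rewrite /l; have := mulr_ge0 (ltW e0) (K0 t); have :=
    mulr_ge0 (ltW e0) t0; lra.
  have /andP[_ h] := inc _ _ (K0 t) lt_.
  have hE : l t - K t = e * (1 + K t + t) by rewrite /l; ring.
  by rewrite hE eE in h; lra.
have [x [x0 xt px plt]] := first_hitting_time t _ t0 cd d0 dt.
have {}sol := solution_onS _ _ _ _ xt sol.
have {}px : psi x = psi1 (l x) by lra.
have pmax s : 0 <= s -> s < x -> psi s < psi x.
  move=> s0 sx; rewrite px; have := plt s s0 sx; have :=
    mono _ _ (l_ge s s0) (l_le s x s0 (ltW sx)); lra.
have xw : psi x < w by have /andP[] : 0 <= psi x < w by apply: pw; rewrite ltW.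
have Fmin s : 0 <= s <= x -> F (psi x) <= F (psi s).
  move=> /andP[s0 sx]; have /andP[h1 _] : 0 <= psi s < w.
    by apply: pw; rewrite s0 (le_trans sx).
  apply: Fdec => //; last exact: ltW.
  by move: sx; rewrite le_eqVlt => /predU1P[->//|sx]; apply/ltW/pmax.
(* Here 1 - q = 1 / (1 + e), so psi grows by at most (1 + e) F (psi x) (K x - K r) from r to x. The
   copy grows by at least this plus e F (psi x) (x - r), the term that keeps the inequality strict
   even where K is flat; this contradicts psi r < psi1 (l r). *)
have q0 : 0 < e / (1 + e) by rewrite divr_gt0//; lra.
have [r [r0 rx prx]] :=
  increment_at_running_max kappaP F psi x _ lF x0 q0 sol pmax Fmin.
have -> : 1 - e / (1 + e) = (1 + e)^-1 by field; rewrite gt_eqF//; lra.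
rewrite mulrC ler_pdivrMr; last by lra.
have m0 : 0 < F (psi x) by apply: Fpos; rewrite xw px andbT; have /andP[] :=
  p1w _ (l_ge x (ltW x0)).
have /andP[h _] := inc _ _ (l_ge r r0) (l_le r x r0 (ltW rx)).
rewrite -px in h; have := plt r r0 rx.
have xr : 0 < x - r by lra.
have := mulr_gt0 m0 (mulr_gt0 e0 xr).
by move: h; rewrite /l; lra.
Qed.

Lemma ode_le_solution F G psi psi1 S : locally_lipschitz F -> locally_lipschitz G ->
  0 <= G 0 -> (forall x y, x <= y -> G x <= G y) -> (forall x, G x <= F x) ->
  solution_on kappa F S psi -> solution_on const_kernel G (K S) psi1 ->
  forall t, 0 <= t <= S -> psi1 (K t) <= psi t.
Proof.
move=> lF lG G0 Gmono GF sol sol1 t tS.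
have /andP[t0 tS'] := tS; have S0 := le_trans t0 tS'.
have K0 := kernel_primitive_ge0 kappaP.
have Kle := kernel_primitive_le kappaP.
have p1 : forall x, 0 <= x <= K S -> 0 <= psi1 x.
  apply: (solution_on_ge0 admissible_const_kernel G) => // s _ ps.
  exact: le_trans (Gmono _ _ ps).
have [_ [_ [A GA]]] := solution_on_bounded _ _ _ lG sol1.
have Gp x : 0 <= x <= K S -> 0 <= G (psi1 x) <= A.
  move=> xS; rewrite (le_trans (ler_norm _) (GA _ xS)) andbT.
  by apply: (le_trans G0); apply: Gmono; exact: p1.
have inc a b m' : 0 <= a -> a <= b -> b <= K S ->
    (forall x, a <= x <= b -> G (psi1 x) <= m') ->
    0 <= psi1 b - psi1 a <= m' * (b - a).
  move=> a0 ab bS Gm; rewrite -{1}(mul0r (b - a)).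
  apply: (ode_increment G psi1 (K S)) => // x xab; rewrite Gm// andbT.
  have /andP[ax xb] := xab.
  by have /andP[] : 0 <= G (psi1 x) <= A by apply: Gp;
    rewrite (le_trans a0 ax) (le_trans xb).
have mono a b : 0 <= a -> a <= b -> b <= K S -> psi1 a <= psi1 b.
  move=> a0 ab bS; rewrite -subr_ge0.
  suff /(inc a b A a0 ab bS)/andP[] : forall x, a <= x <= b -> G (psi1 x) <= A by [].
  move=> x /andP[ax xb].
  by have /andP[] : 0 <= G (psi1 x) <= A by apply: Gp;
    rewrite (le_trans a0 ax) (le_trans xb).
have A0 : 0 <= A by apply: le_trans (GA 0 _); rewrite ?lexx//=.
pose phi s := psi1 (K s).
have cphi : {within `[0, S], continuous phi}.
  apply: (within_continuous_modulus kappaP _ A) => a b a0 ab bS.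
  have b0 := le_trans a0 ab.
  have GA' x : K a <= x <= K b -> G (psi1 x) <= A.
    move=> /andP[ax xb].
    by have /andP[] : 0 <= G (psi1 x) <= A by apply: Gp;
      rewrite (le_trans (K0 a) ax) (le_trans xb)// Kle.
  have /andP[h1 h2] := inc _ _ A (K0 a) (Kle _ _ a0 ab) (Kle _ _ b0 bS) GA'.
  rewrite ger0_norm//; apply: le_trans h2 _; rewrite ler_wpM2l//.
  exact: kernel_primitive_subadd.
have bphi := bounded_measurable_continuous _ _ cphi.
pose g s := G (phi s).
have bg : bounded_measurable S g by exact: bounded_measurable_comp.
have gmono a b : 0 <= a -> a <= b -> b <= S -> g a <= g b.
  by move=> a0 ab bS; apply: Gmono; apply: mono => //; [exact: Kle|apply: Kle => //;
    exact: le_trans ab].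
have phiC s : 0 <= s <= S -> phi s <= C g s.
  move=> /andP[s0 sS]; rewrite -subr_le0 leNgt; apply/negP => gap.
  (* The mesh h is taken so fine that K h (g s - g 0 + 1) is below the supposed gap; the summand 1
     keeps the divisor positive. *)
  have D0 : 0 < g s - g 0 + 1 by have := gmono 0 s (lexx 0) s0 sS; lra.
  have [d d0 Kd] := kernel_primitive_small kappaP _ (divr_gt0 gap D0).
  have := archi_boundP (divr_ge0 s0 (ltW d0)); set n := Num.Def.archi_bound _.
  rewrite ltr_pdivrMr// => snd.
  have n0 : 0 < n%:R :> R.
    by rewrite ltr0n lt0n; apply/eqP => n0; move: snd; rewrite n0 mul0r; lra.
  pose h := s / n%:R.
  have h0 : 0 <= h by rewrite divr_ge0// ltW.
  have hd : h <= d by rewrite ler_pdivrMr// mulrC ltW.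
  have nh : n%:R * h = s by rewrite /h mulrC divfK// gt_eqF.
  (* Each cell adds at most (g b - g a) K h to the defect, and these bounds telescope. *)
  have part i : (i <= n)%N ->
    phi (i%:R * h) - C g (i%:R * h) <= K h * (g (i%:R * h) - g 0).
    elim: i => [_|i IH /[dup] /ltnW /IH {}IH iln].
      rewrite mul0r conv0 !subrr mulr0 /phi kernel_primitive0.
      by rewrite sol1.2 ?lexx ?K0// conv0 subrr.
    pose a := i%:R * h; pose b := i.+1%:R * h.
    have ba : b - a = h by rewrite /b /a -natr1; ring.
    have a0 : 0 <= a by rewrite mulr_ge0.
    have ab : a <= b by lra.
    have bs : b <= s by rewrite -nh ler_wpM2r// ler_nat.
    have bS := le_trans bs sS; have b0 := le_trans a0 ab.
    have KbS := Kle _ _ b0 bS.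
    have Ggb x : K a <= x <= K b -> G (psi1 x) <= g b.
      by move=> /andP[ax xb]; apply: Gmono; apply: mono => //; exact: le_trans ax.
    have /andP[_ h1] := inc _ _ (g b) (K0 a) (Kle _ _ a0 ab) KbS Ggb.
    have h2 := conv_increment_ge kappaP g a b (g a)
      (g a) a0 ab (bounded_measurableS _ _ _ bS bg).
    have {}h2 : g a * (K b - K a - K (b - a)) + g a * K (b - a) <= C g b - C g a.
      apply: h2 => x /andP[x1 x2]; first by apply: gmono => //; exact: le_trans bS.
      by apply: gmono => //; exact: le_trans bS.
    have h3 := kernel_primitive_subadd kappaP _ _ a0 ab.
    have h4 := gmono a b a0 ab bS.
    have h5 : (g b - g a) * (K b - K a) <= (g b - g a) * K h.
      by rewrite -ba ler_wpM2l// subr_ge0.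
    move: IH; rewrite -/a -/b -/(phi a) -/(phi b) => IH.
    by rewrite /phi in IH *; lra.
  have := part n (leqnn n); rewrite nh => H.
  have Kh := Kd h hd; rewrite ltr_pdivlMr// in Kh.
  by have := K0 h; lra.
have [bp bF] := solution_on_bounded _ _ _ lF sol.
have [_ [B phiB]] := bphi; have [_ [B' pB]] := bp.
have [L L0 GL] := lG (Num.max B B').
apply: (volterra_comparison kappaP S L phi psi g (fun s => F (psi s))) => //.
- by move=> s sS; rewrite -(sol.2 s sS).
move=> s sS.
apply: le_trans (_ : G (phi s) - G (psi s) <= _).
  by rewrite lerD2l lerN2.
have [ps|ps] := leP (phi s) (psi s).
  apply: (@le_trans _ _ 0); first by rewrite subr_le0 Gmono.
  by rewrite mulr_ge0// le_max lexx.
apply: le_trans (ler_norm _) _.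
apply: le_trans (GL _ _ _ _) _; rewrite ?le_max ?phiB ?pB ?orbT//.
by rewrite ler_wpM2l// ger0_norm ?subr_ge0 ?(ltW ps)// le_max lexx orbT.
Qed.

(** If psi1 ended at T1 <= K t while psi still exists at t, each x < T1 would be of the form K s
    with s <= t, so psi1 would be bounded by psi and hence global. Continuation is an abstract
    hypothesis because in case (A) psi1 is maximal for F, not for G. *)
Lemma extend_ode_le_solution F G psi psi1 (T T1 : \bar R) :
  locally_lipschitz F -> locally_lipschitz G ->
  0 <= G 0 -> (forall x y, x <= y -> G x <= G y) -> (forall x, G x <= F x) ->
  volterra_solution kappa F T psi -> volterra_solution const_kernel G T1 psi1 ->
  (forall B, (forall t, half_open T1 t -> `|psi1 t| <= B) -> T1 = +oo%E) ->
  forall t, 0 <= t ->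
    (0 <= extend_pinfty T1 psi1 (K t) <= extend_pinfty T psi t)%E.
Proof.
move=> lF lG G0 Gmono GF sol sol1 max1 t t0.
have K0 := kernel_primitive_ge0 kappaP.
have Kle := kernel_primitive_le kappaP.
have p1 x : half_open T1 x -> 0 <= psi1 x.
  move=> T1x; have [x0 _] := T1x.
  have s1 := volterra_solution_on admissible_const_kernel G T1 psi1 x lG sol1 T1x.
  apply: (solution_on_ge0 admissible_const_kernel G psi1 x lG G0 s1); last
    by rewrite x0 lexx.
  by move=> s _ ps; exact: le_trans (Gmono _ _ ps).
have le_psi s : 0 <= s <= t -> (t%:E < T)%E -> ((K s)%:E < T1)%E ->
  psi1 (K s) <= psi s.
  move=> /andP[s0 st] tT sT1.
  have Ts : half_open T s by apply: half_open_le (_ : half_open T t) s0 st.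
  apply: (ode_le_solution F G psi psi1 s) => //; last by rewrite s0 lexx.
    exact: volterra_solution_on Ts.
  exact: (volterra_solution_on admissible_const_kernel) sol1 _.
rewrite /extend_pinfty.
case: ifPn => KT1; last first.
  case: ifPn => tT; last by rewrite !leey.
  exfalso.
  suff : T1 = +oo%E by move=> E; move: KT1; rewrite E ltry.
  have sol_t : solution_on kappa F t psi
    by exact: (volterra_solution_on kappaP) sol _.
  have [[_ [B pB]] _] := solution_on_bounded _ _ _ lF sol_t.
  apply: (max1 B) => x T1x; have [x0 xT1] := T1x.
  have xK : x <= K t.
    by move: KT1; rewrite -leNgt => /(lt_le_trans xT1); rewrite lte_fin => /ltW.
  have cK : {within `[0, t], continuous K}.
    apply: (within_continuous_modulus kappaP _ 1) => a b a0 ab bt.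
    rewrite mul1r ger0_norm ?subr_ge0 ?Kle//; exact: kernel_primitive_subadd.
  have [] := IVT t0 cK (v := x).
    by rewrite kernel_primitive0 ge_min x0 le_max xK orbT.
  move=> s; rewrite in_itv/= => st sx.
  rewrite ger0_norm ?p1// -sx; apply: le_trans (le_psi s st tT _) _; first
    by rewrite sx.
  exact: le_trans (ler_norm _) (pB _ st).
rewrite lee_fin p1/=; last by split.
case: ifPn => tT; last by rewrite leey.
by rewrite lee_fin le_psi// t0 lexx.
Qed.

End Comparison.

(** * The Heston case *)

Section Reversal.
Context {R : realType} {kappa : R -> R}.
Hypothesis kappaP : admissible_kernel kappa.
Implicit Types (F psi : R -> R) (S t : R).

Lemma solution_on_eq0 F psi S : locally_lipschitz F -> F 0 = 0 ->
  solution_on kappa F S psi -> forall t, 0 <= t <= S -> psi t = 0.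
Proof.
move=> lF F0 sol t tS; have [bp _] := solution_on_bounded _ _ _ lF sol.
apply: (volterra_unique kappaP F S psi (cst 0) lF bp (bounded_measurable_cst S 0)) =>
  //.
  exact: sol.2.
move=> s _; rewrite (_ : (fun _ => _) = cst 0) ?conv_cst0//.
by apply/funext => x; rewrite /= F0.
Qed.

Definition reverse F : R -> R := fun x => - F (- x).

Lemma locally_lipschitz_reverse F : locally_lipschitz F ->
  locally_lipschitz (reverse F).
Proof.
move=> lF B; have [L L0 FL] := lF B; exists L => // x y xB yB.
rewrite /reverse (_ : - F (- x) - - F (- y) = F (- y) - F (- x)); last by ring.
by rewrite (_ : x - y = - y - - x); [apply: FL; rewrite normrN|ring].
Qed.

Lemma solution_on_reverse F psi S : locally_lipschitz F ->
  solution_on kappa F S psi -> solution_on kappa (reverse F) S (fun s => - psi s).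
Proof.
move=> lF sol; split; first by move=> x; apply: cvgN; exact: sol.1.
move=> t tS; have /andP[t0 tS'] := tS.
have [_ bF] := solution_on_bounded _ _ _ lF (solution_onS _ _ _ _ tS' sol).
rewrite sol.2// -convN//; apply: eq_conv => s _; by rewrite /reverse opprK.
Qed.

End Reversal.

Section Heston.
Context {R : realType} (lambda eta rho u : R).
Hypothesis eta0 : 0 < eta.
Local Notation F := (hestonR lambda eta rho u).
Local Notation G := (hestonRbar lambda eta rho u).
Local Notation b := (c2 lambda eta rho u).
Local Notation m := (w0 lambda eta rho u).
Local Notation D := (Delta lambda eta rho u).
Local Notation ws := (wstar lambda eta rho u).

Lemma derive1_hestonR0 : ((F^`())%classic 0) = b.
Proof.
rewrite derive1E.
have : is_derive (0 : R) 1 F b.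
  rewrite /hestonR; apply: is_derive_eq.
  by rewrite /GRing.scale/=; ring.
by move=> h; rewrite derive_val.
Qed.

(** Factorization about the vertex of the parabola; monotonicity on either side is then a matter of
    signs. *)
Lemma hestonR_sub x y : F y - F x = (y - x) * (eta ^+ 2 / 2) * ((y - m) + (x - m)).
Proof. by rewrite /hestonR /w0; field; rewrite gt_eqF. Qed.

Lemma hestonR_le x y : m <= x -> x <= y -> F x <= F y.
Proof.
move=> mx xy; rewrite -subr_ge0 hestonR_sub.
apply: mulr_ge0; last by lra.
by apply: mulr_ge0; [lra|rewrite divr_ge0// exprn_ge0// ltW].
Qed.

Lemma hestonR_ge x y : x <= y -> y <= m -> F y <= F x.
Proof.
move=> xy ym; rewrite -subr_le0 hestonR_sub.
apply: mulr_ge0_le0; last by lra.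
by apply: mulr_ge0; [lra|rewrite divr_ge0// exprn_ge0// ltW].
Qed.

Lemma hestonR_gt x y : x < y -> y <= m -> F y < F x.
Proof.
move=> xy ym; rewrite -subr_lt0 hestonR_sub.
rewrite pmulr_rlt0; first by lra.
by apply: mulr_gt0; [lra|rewrite divr_gt0// exprn_gt0].
Qed.

Lemma hestonR_min x : F m <= F x.
Proof. by have [mx|/ltW xm] := leP m x; [exact: hestonR_le|exact: hestonR_ge]. Qed.

Lemma hestonR_w0 : F m = - (2 * D / eta ^+ 2).
Proof. by rewrite /hestonR /w0 /Delta /c2; field; rewrite gt_eqF. Qed.

Lemma Delta_ge0 x : F x <= 0 -> 0 <= D.
Proof.
move=> Fx; have := le_trans (hestonR_min x) Fx.
by rewrite hestonR_w0 oppr_le0 pmulr_lge0 ?invr_gt0 ?exprn_gt0// pmulr_rge0.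
Qed.

Lemma wstar_le_w0 : ws <= m.
Proof.
rewrite /wstar /w0 mulrC ler_wpM2r// ?invr_ge0 ?exprn_ge0 ?(ltW eta0)//.
by rewrite lerBlDr lerDl mulr_ge0// sqrtr_ge0.
Qed.

Lemma hestonR_wstar : 0 <= D -> F ws = 0.
Proof.
move=> D0; have : F ws - F m = 2 * (Num.sqrt D) ^+ 2 / eta ^+ 2.
  by rewrite hestonR_sub /wstar /w0; field; rewrite gt_eqF.
by rewrite sqr_sqrtr// hestonR_w0; lra.
Qed.

Lemma hestonR_lipschitz : locally_lipschitz F.
Proof.
move=> B; exists (`|eta ^+ 2 / 2| * (2 * `|B| + 2 * `|m|)).
  by rewrite mulr_ge0// addr_ge0// mulr_ge0.
move=> x y xB yB; rewrite hestonR_sub normrM normrM mulrC [`|x - y| * _]mulrC mulrA.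
apply: ler_wpM2r => //; rewrite mulrC; apply: ler_wpM2l => //.
apply: le_trans (ler_normD _ _) _.
have := ler_normB x m; have := ler_normB y m; have := ler_norm B; lra.
Qed.

(** In this form the monotonicity and Lipschitz bounds of [hestonRbar] follow from those of
    [hestonR]. *)
Lemma hestonRbarE x : G x = F (Num.max x m).
Proof. by rewrite /hestonRbar; case: leP. Qed.

Lemma hestonRbar_lipschitz : locally_lipschitz G.
Proof.
move=> B; have [L L0 FL] := hestonR_lipschitz (Num.max B `|m|).
exists L => // x y xB yB; rewrite !hestonRbarE.
have mB z : `|z| <= B -> `|Num.max z m| <= Num.max B `|m|.
  by move=> zB; case: (leP z m) => _; rewrite le_max ?zB ?lexx ?orbT.
apply: le_trans (FL _ _ (mB _ xB) (mB _ yB)) _; apply: ler_wpM2l => //.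
have /andP[h1 h2] : - `|x - y| <= x - y <= `|x - y| by rewrite -ler_norml.
by rewrite ler_norml; case: (leP x m) => ?; case: (leP y m) => ?;
  apply/andP; split; lra.
Qed.

Lemma hestonRbar_le x y : x <= y -> G x <= G y.
Proof.
move=> xy; rewrite !hestonRbarE; apply: hestonR_le; first by rewrite le_max lexx orbT.
by rewrite ge_max !le_max xy lexx orbT.
Qed.

Lemma hestonRbar_le_hestonR x : G x <= F x.
Proof. by rewrite hestonRbarE; case: (leP x m) => // _; exact: hestonR_min. Qed.

Section Cases.
Context (kappa psik psi1 : R -> R) (Tk T1 : \bar R).
Hypothesis kappaP : admissible_kernel kappa.
Hypothesis maxk : maximal_solution kappa F Tk psik.
Hypothesis max1 : maximal_solution const_kernel F T1 psi1.
Local Notation K := (kernel_primitive kappa).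
Let lF := hestonR_lipschitz.
Let constP := @admissible_const_kernel R.
Let solk : volterra_solution kappa F Tk psik. Proof. by case: maxk. Qed.
Let sol1 : volterra_solution const_kernel F T1 psi1. Proof. by case: max1. Qed.
Let solk_on t : half_open Tk t -> solution_on kappa F t psik.
Proof. exact: volterra_solution_on. Qed.
Let sol1_on t : half_open T1 t -> solution_on const_kernel F t psi1.
Proof. exact: (volterra_solution_on constP). Qed.
Let Tk_global B : (forall t, half_open Tk t -> `|psik t| <= B) -> Tk = +oo%E.
Proof. by apply: (maximal_bounded_global kappaP _ _ _ _ lF). Qed.
Let T1_global B : (forall t, half_open T1 t -> `|psi1 t| <= B) -> T1 = +oo%E.
Proof. by apply: (maximal_bounded_global constP _ _ _ _ lF). Qed.
Let half_open_pinfty (t : R) : 0 <= t -> half_open +oo%E t.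
Proof. by move=> t0; split => //; rewrite ltry. Qed.

(** A nonnegative slope at 0 puts the vertex at or left of 0, so [hestonR] and [hestonRbar] agree on
    the nonnegative half-line, where psi1 lives. *)
Lemma comparison_caseA : caseA lambda eta rho u -> forall t, 0 <= t ->
  (0 <= extend_pinfty T1 psi1 (K t) <= extend_pinfty Tk psik t)%E.
Proof.
rewrite /caseA derive1_hestonR0 => -[F0 b0].
have m0 : m <= 0 by rewrite /w0 mulNr oppr_le0 divr_ge0// exprn_ge0// ltW.
have GF x : 0 <= x -> G x = F x by move=> x0;
  rewrite hestonRbarE max_l// (le_trans m0).
have p1 x : half_open T1 x -> 0 <= psi1 x.
  move=> T1x; apply: (solution_on_ge0 constP F psi1 x lF (ltW F0) (sol1_on _ T1x)).
    by move=> s _ ps; rewrite (le_trans (ltW F0))// hestonR_le.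
  by rewrite T1x.1 lexx.
apply: (extend_ode_le_solution kappaP F G) => //.
- exact: hestonRbar_lipschitz.
- by rewrite GF// ltW.
- exact: hestonRbar_le.
- exact: hestonRbar_le_hestonR.
- apply/(volterra_solutionP constP); first exact: hestonRbar_lipschitz.
    exact: sol1.1.
  move=> t T1t; rewrite ((volterra_solutionP constP _ _ _ lF sol1.1).1 sol1)//.
  apply: eq_conv => s /andP[s0 st]; rewrite GF// p1//; exact: half_open_le T1t s0 st.
Qed.

(** The minimum of the parabola is nonnegative, for otherwise [wstar] would be a root; hence G 0 >=
    0. *)
Lemma comparison_caseB : caseB lambda eta rho u ->
  forall psibar Tbar, maximal_solution const_kernel G Tbar psibar ->
  forall t, 0 <= t ->
  (0 <= extend_pinfty Tbar psibar (K t) <= extend_pinfty Tk psik t)%E.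
Proof.
move=> [F0 b0 noroot] psibar Tbar maxbar.
have Fm : 0 <= F m.
  rewrite leNgt; apply/negP => Fm; apply: noroot; exists ws.
  by apply: hestonR_wstar; exact: Delta_ge0 (ltW Fm).
have lG := hestonRbar_lipschitz.
apply: (extend_ode_le_solution kappaP F G) => //.
- by rewrite hestonRbarE (le_trans Fm)// hestonR_min.
- exact: hestonRbar_le.
- exact: hestonRbar_le_hestonR.
- by case: maxbar.
- move=> B; exact: (maximal_bounded_global constP _ _ _ _ lG maxbar).
Qed.

(** The root [wstar] is positive, since F is decreasing left of the vertex and F 0 > 0; so on
    [[0, wstar]] F decreases to 0, the setting of [solution_le_ode]. *)
Lemma comparison_caseC : caseC lambda eta rho u ->
  Tk = +oo%E /\ forall t, 0 <= t ->
    (0 <= extend_pinfty Tk psik t)%E /\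
    (extend_pinfty Tk psik t <= extend_pinfty T1 psi1 (K t) <= ws%:E)%E.
Proof.
rewrite /caseC derive1_hestonR0 => -[F0 b0 [w _ Fw]].
have m0 : 0 <= m by rewrite /w0 divr_ge0 ?oppr_ge0 ?(ltW b0)// exprn_ge0// ltW.
have Fws := hestonR_wstar (Delta_ge0 w (ltac:(by rewrite Fw))).
have wm := wstar_le_w0.
have ws0 : 0 < ws.
  rewrite ltNge; apply/negP => ws0; have := hestonR_ge _ _ ws0 m0.
  by rewrite Fws; lra.
have Fpos x : 0 <= x < ws -> 0 < F x.
  by move=> /andP[_ xw]; rewrite -Fws; exact: hestonR_gt.
have Fge x : 0 <= x <= ws -> 0 <= F x.
  by move=> /andP[_ xw]; rewrite -Fws; exact: hestonR_ge.
have Fdec x y : 0 <= x -> x <= y -> y <= ws -> F y <= F x.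
  by move=> _ xy yw; apply: hestonR_ge => //; exact: le_trans wm.
have pk t : half_open Tk t -> 0 <= psik t < ws.
  move=> Tt; apply: (solution_on_lt kappaP F psik t ws lF ws0 Fws Fge (solk_on _ Tt)).
  by rewrite Tt.1 lexx.
have p1 t : half_open T1 t -> 0 <= psi1 t < ws.
  move=> Tt; apply: (solution_on_lt constP F psi1 t ws lF ws0 Fws Fge (sol1_on _ Tt)).
  by rewrite Tt.1 lexx.
have Tky : Tk = +oo%E.
  by apply: (Tk_global ws) => t /pk/andP[h1 h2]; rewrite ger0_norm// ltW.
have T1y : T1 = +oo%E.
  by apply: (T1_global ws) => t /p1/andP[h1 h2]; rewrite ger0_norm// ltW.
split => // t t0; rewrite /extend_pinfty Tky T1y !ltry !lee_fin.
have K0 := kernel_primitive_ge0 kappaP t.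
have Tt : half_open Tk t by rewrite Tky; exact: half_open_pinfty.
have T1K : half_open T1 (K t) by rewrite T1y; exact: half_open_pinfty.
have /andP[-> _] := pk t Tt; have /andP[_ /ltW ->] := p1 _ T1K.
split => //; rewrite andbT.
apply: (solution_le_ode kappaP F ws psik psi1 t) => //; first exact: solk_on.
  by move=> s s0; apply: sol1_on; rewrite T1y; exact: half_open_pinfty.
by rewrite t0 lexx.
Qed.

(** If F 0 = 0, both solutions vanish. If F 0 < 0, both negated solutions stay in [[0, - wstar[],
    while their comparison relies on F decreasing on [[wstar, 0]], which c2 <= 0 ensures by putting
    the vertex at or right of 0. *)
Lemma comparison_caseD : caseD lambda eta rho u ->
  Tk = +oo%E /\ forall t, 0 <= t ->
    let x := extend_pinfty T1 psi1 (K t) in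
    let y := extend_pinfty Tk psik t in
    [/\ (ws%:E <= x <= 0)%E /\ (ws%:E <= y <= 0)%E,
        ws < 0 -> (ws%:E < x)%E /\ (ws%:E < y)%E,
        F 0 < 0 -> 0 < K t -> (x < 0)%E /\ (y < 0)%E &
        b <= 0 \/ F 0 = 0 -> (x <= y)%E].
Proof.
rewrite /caseD => F0.
have Fws := hestonR_wstar (Delta_ge0 0 F0).
have wm := wstar_le_w0.
have ws_le0 : ws <= 0.
  rewrite leNgt; apply/negP => ws0; have := hestonR_gt _ _ ws0 wm.
  by rewrite Fws; lra.
have K0 := kernel_primitive_ge0 kappaP.
move: F0; rewrite le_eqVlt => /predU1P[F0|F0].
  have pk t : half_open Tk t -> psik t = 0.
    move=> Tt; apply: (solution_on_eq0 kappaP F psik t lF F0 (solk_on _ Tt)).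
    by rewrite Tt.1 lexx.
  have p1 t : half_open T1 t -> psi1 t = 0.
    move=> Tt; apply: (solution_on_eq0 constP F psi1 t lF F0 (sol1_on _ Tt)).
    by rewrite Tt.1 lexx.
  have Tky : Tk = +oo%E by apply: (Tk_global 0) => t /pk ->; rewrite normr0.
  have T1y : T1 = +oo%E by apply: (T1_global 0) => t /p1 ->; rewrite normr0.
  split => // t t0; rewrite /extend_pinfty Tky T1y !ltry /= pk; last first.
    by rewrite Tky; exact: half_open_pinfty.
  rewrite p1; last by rewrite T1y; exact: half_open_pinfty.
  by rewrite !lee_fin !lte_fin ws_le0 lexx; split => //; rewrite F0 ltxx.
have ws0 : ws < 0.
  by rewrite lt_neqAle ws_le0 andbT; apply/eqP => e; move: Fws; rewrite e; lra.
have w0' : 0 < - ws by rewrite oppr_gt0.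
pose H := reverse F.
have lH : locally_lipschitz H by exact: locally_lipschitz_reverse.
have Hw : H (- ws) = 0 by rewrite /H /reverse opprK Fws oppr0.
have H0 : 0 < H 0 by rewrite /H /reverse oppr0 oppr_gt0.
(* The vertex may lie inside [[wstar, 0]]: the decreasing branch is controlled by F [wstar] = 0, the
   increasing one by F 0 < 0. *)
have Hge x : 0 <= x <= - ws -> 0 <= H x.
  move=> /andP[x0 xw]; rewrite /H /reverse oppr_ge0.
  have [mx|/ltW xm] := leP m (- x).
    by apply: le_trans (ltW F0); apply: hestonR_le => //; lra.
  by rewrite -Fws; apply: hestonR_ge => //; lra.
have Hk t : half_open Tk t -> solution_on kappa H t (fun s => - psik s).
  by move=> Tt; apply: solution_on_reverse => //; exact: solk_on.
have H1 t : half_open T1 t -> solution_on const_kernel H t (fun s => - psi1 s).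
  by move=> Tt; apply: solution_on_reverse => //; exact: sol1_on.
have pk t : half_open Tk t -> 0 <= - psik t < - ws.
  move=> Tt; apply: (solution_on_lt kappaP H _ t (- ws) lH w0' Hw Hge (Hk _ Tt)).
  by rewrite Tt.1 lexx.
have p1 t : half_open T1 t -> 0 <= - psi1 t < - ws.
  move=> Tt; apply: (solution_on_lt constP H _ t (- ws) lH w0' Hw Hge (H1 _ Tt)).
  by rewrite Tt.1 lexx.
have Tky : Tk = +oo%E.
  by apply: (Tk_global (- ws)) => t /pk/andP[h1 h2]; rewrite -normrN ger0_norm// ltW.
have T1y : T1 = +oo%E.
  by apply: (T1_global (- ws)) => t /p1/andP[h1 h2]; rewrite -normrN ger0_norm// ltW.
split => // t t0; rewrite /extend_pinfty Tky T1y !ltry /= !lee_fin !lte_fin.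
have Tkt s : 0 <= s -> half_open Tk s by rewrite Tky; exact: half_open_pinfty.
have T1t s : 0 <= s -> half_open T1 s by rewrite T1y; exact: half_open_pinfty.
have /andP[k1 k2] := pk t (Tkt _ t0).
have /andP[l1 l2] := p1 _ (T1t _ (K0 t)).
split.
- by split; apply/andP; split; lra.
- by move=> _; split; lra.
- move=> _ Kt; rewrite -![_ < 0]oppr_gt0; split.
    apply: (solution_on_gt0 constP H _ (K t) lH H0 (K0 t) (H1 _ (T1t _ (K0 t)))).
      move=> s /andP[s0 _]; apply: Hge; by have /andP[h1 /ltW h2] := p1 _ (T1t s s0);
        rewrite h1.
    by rewrite kernel_primitive_const.
  apply: (solution_on_gt0 kappaP H _ t lH H0 t0 (Hk _ (Tkt _ t0))) => //.
  move=> s /andP[s0 _]; apply: Hge; by have /andP[h1 /ltW h2] := pk _ (Tkt s s0);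
    rewrite h1.
- case=> [b0|]; last by lra.
  have m0 : 0 <= m by rewrite /w0 divr_ge0 ?oppr_ge0// exprn_ge0// ltW.
  rewrite -lerN2.
  apply: (solution_le_ode kappaP H (- ws) (fun s => - psik s)
    (fun s => - psi1 s) t) => //.
  + move=> x /andP[x0 xw]; rewrite /H /reverse oppr_gt0 -Fws.
    by apply: hestonR_gt; lra.
  + by move=> x y x0 xy _; rewrite /H /reverse lerN2; apply: hestonR_ge; lra.
  + exact: Hk (Tkt _ t0).
  + by move=> s s0; exact: H1 (T1t _ s0).
  + by rewrite t0 lexx.
Qed.

End Cases.
End Heston.

Theorem theorem3p5 (R : realType) (lambda eta rho : R)
  (hlambda : 0 < lambda) (heta : 0 < eta) (hrho1 : -1 < rho) (hrho2 : rho < 1)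
  (kappa : R -> R)
  (hkappa : nonneg_decreasing kappa) (hint : locally_integrable0 kappa)
  (u : R)
  (psik : R -> R) (Tk : \bar R)
  (hpsik : maximal_solution kappa (hestonR lambda eta rho u) Tk psik)
  (psi1 : R -> R) (T1 : \bar R)
  (hpsi1 : maximal_solution const_kernel (hestonR lambda eta rho u) T1 psi1) :
  [/\ (* a *)
      caseA lambda eta rho u ->
      forall t : R, 0 <= t ->
        (0 <= extend_pinfty T1 psi1 (kernel_primitive kappa t) <= extend_pinfty Tk psik t)%E,
      (* b *)
      caseB lambda eta rho u ->
      forall (psibar : R -> R) (Tbar : \bar R),
        maximal_solution const_kernel (hestonRbar lambda eta rho u) Tbar psibar ->
        forall t : R, 0 <= t ->
          (0 <= extend_pinfty Tbar psibar (kernel_primitive kappa t)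
             <= extend_pinfty Tk psik t)%E,
      (* c *)
      caseC lambda eta rho u ->
      Tk = +oo%E /\
      forall t : R, 0 <= t ->
        (0 <= extend_pinfty Tk psik t)%E /\
        (extend_pinfty Tk psik t <= extend_pinfty T1 psi1 (kernel_primitive kappa t)
           <= (wstar lambda eta rho u)%:E)%E &
      (* d *)
      caseD lambda eta rho u ->
      (* Strictness on the left is lost exactly when wstar u = 0; strictness on
         the right exactly when R(u,0) = 0 or kappa integrates to 0 on [0, t]
         (in particular at t = 0).  If R(u,0) < 0 < c2 u, then R(u,.) increases
         near 0 and the comparison of the two solutions is reversed for small t
         unless kappa is constant near 0; all other bounds remain true. *)
      Tk = +oo%E /\
      forall t : R, 0 <= t ->
        let K := kernel_primitive kappa t in
        let x := extend_pinfty T1 psi1 K in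
        let y := extend_pinfty Tk psik t in
        let w := wstar lambda eta rho u in
        [/\ (w%:E <= x <= 0)%E /\ (w%:E <= y <= 0)%E,
            w < 0 -> (w%:E < x)%E /\ (w%:E < y)%E,
            hestonR lambda eta rho u 0 < 0 -> 0 < K -> (x < 0)%E /\ (y < 0)%E &
            c2 lambda eta rho u <= 0 \/ hestonR lambda eta rho u 0 = 0 ->
            (x <= y)%E]].

Proof.
have kappaP : admissible_kernel kappa by split.
split.
- exact: comparison_caseA.
- exact: comparison_caseB.
- exact: comparison_caseC.
- exact: comparison_caseD.
Qed.
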